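(* For every $g\in G$, the point $[g]\in AdS_l$ belongs to the singularity $\mathcal S_l$ if and only if $\|J_1^*\|_{[g]}=\|\operatorname{pr}_{\mathfrak q}\operatorname{Ad}(g^{-1})J_1\|=0$; that is, $\|J_1^*\|_{[g]}=\|\operatorname{pr}_{\mathfrak q}\operatorname{Ad}(g^{-1})J_1\|$ and the singularity is exactly the vanishing locus of this quantity.
   Context: Let $l\ge 3$. Here $SO(p,q)$ denotes the identity component of the special orthogonal group of signature $(p,q)$. Let $G=SO(2,l-1)$ act on $\mathbb R^{2,l-1}$ (two positive and $l-1$ negative directions), let $H=SO(1,l-1)\subset G$ be the stabilizer of a vector of square norm $+1$, with Lie algebras $\mathfrak g,\mathfrak h$, let $B$ be the Killing form of $\mathfrak g$, and let $AdS_l=G/H$ with projection $\pi:G\to G/H$, $[g]=\pi(g)$. Let $\sigma$ be the involutive automorphism of $\mathfrak g$ whose $+1$-eigenspace is $\mathfrak h$, and let $\mathfrak q$ be its $-1$-eigenspace; $\operatorname{pr}_{\mathfrak q}$ is the projection of $\mathfrak g=\mathfrak h\oplus\mathfrak q$ onto $\mathfrak q$. Let $\theta$ be a Cartan involution of $\mathfrak g$ commuting with $\sigma$, with $-1$-eigenspace $\mathfrak p$. Let $\mathfrak a\subset\mathfrak p$ be a maximal abelian subalgebra with a basis $J_1\in\mathfrak h$, $J_2\in\mathfrak q$, normalized so that, writing $\mathfrak g_{(\alpha,\beta)}=\{X\in\mathfrak g:[J_1,X]=\alpha X,\ [J_2,X]=\beta X\}$, the restricted roots are $(\pm1,\pm1)$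 and, if $l\ge4$, $(\pm1,0),(0,\pm1)$. Let $\mathfrak n=\mathfrak g_{(1,1)}\oplus\mathfrak g_{(1,-1)}\oplus\mathfrak g_{(1,0)}\oplus\mathfrak g_{(0,1)}$, $\bar{\mathfrak n}=\theta\mathfrak n$, and let $A,N,\bar N$ be the connected subgroups of $G$ with Lie algebras $\mathfrak a,\mathfrak n,\bar{\mathfrak n}$; $AN$ and $A\bar N$ act on $AdS_l$ by $r\cdot[g]=[rg]$. Singularity: $\mathcal S_l\subset AdS_l$ is the union of the closed orbits of $AN$ and of the closed orbits of $A\bar N$ in $AdS_l$. Norms: on $\mathfrak g$, $\|X\|$ denotes the (indefinite, quadratic) quantity $-\frac{1}{2(l-1)}B(X,X)$. The same normalization of $B$ restricted to $\mathfrak q\cong T_{[e]}AdS_l$ induces a $G$-invariant Lorentzian metric on $AdS_l$, and $\|v\|_{[g]}$ denotes the corresponding square norm of a tangent vector $v$ at $[g]$. The fundamental vector field of $J_1$ is $(J_1^* )_{[g]}=\frac{d}{dt}\big|_{t=0}\pi(e^{-tJ_1}g)$. *)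

(* Defs.v *)
From HB Require Import structures.
From mathcomp Require Import all_boot all_order all_algebra.
From mathcomp Require Import all_classical all_reals all_analysis.

Set Implicit Arguments.
Unset Strict Implicit.
Unset Printing Implicit Defensive.

Import Order.TTheory GRing.Theory Num.Theory.
Import numFieldNormedType.Exports.

Local Open Scope classical_set_scope.
Local Open Scope ring_scope.

Definition form_mx (R : realType) (l : nat) : 'M[R]_l.+1 :=
  diag_mx (\row_(i < l.+1) (if (i < 2)%N then 1 else -1)).

Definition bilin_form (R : realType) (l : nat) (x y : 'cV[R]_l.+1) : R :=
  (x^T *m form_mx R l *m y) 0 0.

Definition special_orthogonal (R : realType) (l : nat) : set 'M[R]_l.+1 :=
  [set g | g^T *m form_mx R l *m g = form_mx R l /\ \det g = 1].
Arguments special_orthogonal : clear implicits.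

(* The identity component of the group above (usually denoted SO_0(2, l-1)). *)
Definition SO2 (R : realType) (l : nat) : set 'M[R]_l.+1 :=
  connected_component (special_orthogonal R l) 1%:M.
Arguments SO2 : clear implicits.

Definition isotropy (R : realType) (l : nat) (v : 'cV[R]_l.+1) :
    set 'M[R]_l.+1 :=
  [set g | SO2 R l g /\ g *m v = v].

Definition lie (R : realType) (l : nat) (X Y : 'M[R]_l.+1) : 'M[R]_l.+1 :=
  X *m Y - Y *m X.

Fact lie_is_linear (R : realType) (l : nat) (X : 'M[R]_l.+1) :
  linear (lie X).
Proof.
move=> a Y Z; rewrite /lie mulmxDr mulmxDl -scalemxAr -scalemxAl.
by rewrite scalerBr opprD addrACA.
Qed.

HB.instance Definition _ (R : realType) (l : nat) (X : 'M[R]_l.+1) :=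
  GRing.isLinear.Build R 'M[R]_l.+1 'M[R]_l.+1 *:%R (lie X)
    (lie_is_linear X).

Definition ad (R : realType) (l : nat) (X : 'M[R]_l.+1) : 'End('M[R]_l.+1) :=
  linfun (lie X).

Fact adE (R : realType) (l : nat) (X Y : 'M[R]_l.+1) : ad X Y = lie X Y.
Proof. exact: lfunE. Qed.

Definition Ad (R : realType) (l : nat) (g X : 'M[R]_l.+1) : 'M[R]_l.+1 :=
  g *m X *m invmx g.

Definition expm (R : realType) (l : nat) (X : 'M[R]_l.+1) : 'M[R]_l.+1 :=
  limn (series (fun k : nat => (k`!%:R)^-1 *: X ^+ k)).

Definition is_lie_algebra_of (R : realType) (l : nat)
    (K : set 'M[R]_l.+1) (U : {vspace 'M[R]_l.+1}) : Prop :=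
  forall X, X \in U <-> forall t : R, K (expm (t *: X)).

Definition is_subgroup (R : realType) (l : nat) (K : set 'M[R]_l.+1) : Prop :=
  [/\ K 1%:M,
      forall x y, K x -> K y -> K (x *m y)
    & forall x, K x -> K (invmx x)].

(* The connected (analytic) subgroup with Lie algebra U: the subgroup
   generated by exp U. *)
Definition connected_subgroup (R : realType) (l : nat)
    (U : {vspace 'M[R]_l.+1}) : set 'M[R]_l.+1 :=
  smallest (@is_subgroup R l) (@expm R l @` [set` U]).

(* The trace of ad X \o ad Y on the subspace gg (meaningful when gg is a Lie
   algebra containing X and Y; independent of the chosen basis). *)
Definition killing (R : realType) (l : nat) (gg : {vspace 'M[R]_l.+1})
    (X Y : 'M[R]_l.+1) : R :=
  \sum_(i < \dim gg) coord (vbasis gg) i (ad X (ad Y (vbasis gg)`_i)).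

(* The indefinite square norm - B(X, X) / (2 (l - 1)). *)
Definition sqnorm (R : realType) (l : nat) (gg : {vspace 'M[R]_l.+1})
    (X : 'M[R]_l.+1) : R :=
  - ((2 * (l%:R - 1))^-1 * killing gg X X).

(* Only the restriction of f to gg is significant. *)
Definition is_involutive_automorphism (R : realType) (l : nat)
    (gg : {vspace 'M[R]_l.+1}) (f : 'End('M[R]_l.+1)) : Prop :=
  [/\ forall X, X \in gg -> f X \in gg,
      forall X, X \in gg -> f (f X) = X
    & forall X Y, X \in gg -> Y \in gg -> f (lie X Y) = lie (f X) (f Y)].

Definition is_cartan_involution (R : realType) (l : nat)
    (gg : {vspace 'M[R]_l.+1}) (theta : 'End('M[R]_l.+1)) : Prop :=
  is_involutive_automorphism gg theta /\
  forall X, X \in gg -> X != 0 -> 0 < - killing gg X (theta X).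

Definition is_abelian (R : realType) (l : nat) (U : {vspace 'M[R]_l.+1}) :
    Prop :=
  forall X Y, X \in U -> Y \in U -> lie X Y = 0.

Definition is_maximal_abelian (R : realType) (l : nat)
    (aa pp : {vspace 'M[R]_l.+1}) : Prop :=
  [/\ (aa <= pp)%VS, is_abelian aa
    & forall bb : {vspace 'M[R]_l.+1},
        (bb <= pp)%VS -> is_abelian bb -> (aa <= bb)%VS -> bb = aa].

Definition root_space (R : realType) (l : nat) (gg : {vspace 'M[R]_l.+1})
    (J1 J2 : 'M[R]_l.+1) (alpha beta : R) : {vspace 'M[R]_l.+1} :=
  (gg :&: passmx.leigenspace (ad J1) alpha :&: passmx.leigenspace (ad J2) beta)%VS.

Definition is_restricted_root (R : realType) (l : nat)
    (gg : {vspace 'M[R]_l.+1}) (J1 J2 : 'M[R]_l.+1) (r : R * R) : Prop :=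
  r <> (0, 0) /\ root_space gg J1 J2 r.1 r.2 <> 0%VS.

Definition root_list (R : realType) (l : nat) : seq (R * R) :=
  [:: (1, 1); (1, -1); (-1, 1); (-1, -1)] ++
  (if (4 <= l)%N then [:: (1, 0); (-1, 0); (0, 1); (0, -1)] else [::]).

Definition nilpotent_part (R : realType) (l : nat)
    (gg : {vspace 'M[R]_l.+1}) (J1 J2 : 'M[R]_l.+1) : {vspace 'M[R]_l.+1} :=
  (root_space gg J1 J2 1 1 + root_space gg J1 J2 1 (-1) +
   root_space gg J1 J2 1 0 + root_space gg J1 J2 0 1)%VS.

(* A point of AdS_l = G/H is a left coset gH, as a set of matrices; here H is
   the stabilizer of v. *)
Definition AdS_proj (R : realType) (l : nat) (v : 'cV[R]_l.+1)
    (g : 'M[R]_l.+1) : set 'M[R]_l.+1 :=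
  [set g *m h | h in isotropy v].

Definition AdS (R : realType) (l : nat) (v : 'cV[R]_l.+1) :
    set (set 'M[R]_l.+1) :=
  AdS_proj v @` SO2 R l.

(* r . [g] = [r g] *)
Definition AdS_act (R : realType) (l : nat) (r : 'M[R]_l.+1)
    (p : set 'M[R]_l.+1) : set 'M[R]_l.+1 :=
  [set r *m x | x in p].

Definition AdS_orbit (R : realType) (l : nat) (K : set 'M[R]_l.+1)
    (p : set 'M[R]_l.+1) : set (set 'M[R]_l.+1) :=
  [set AdS_act r p | r in K].

(* Closedness for the quotient topology of G/H: the preimage by the projection
   is closed in G (the topology of [subspace G] only sees the trace on G). *)
Definition closed_AdS (R : realType) (l : nat) (v : 'cV[R]_l.+1)
    (C : set (set 'M[R]_l.+1)) : Prop :=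
  closed (AdS_proj v @^-1` C : set (subspace (SO2 R l))).

Definition closed_orbits (R : realType) (l : nat) (v : 'cV[R]_l.+1)
    (K : set 'M[R]_l.+1) : set (set (set 'M[R]_l.+1)) :=
  [set O | closed_AdS v O /\ exists2 p, AdS v p & O = AdS_orbit K p].

Definition product_set (R : realType) (l : nat) (K L : set 'M[R]_l.+1) :
    set 'M[R]_l.+1 :=
  [set x | exists a n, [/\ K a, L n & x = a *m n]].

Definition singularity (R : realType) (l : nat) (v : 'cV[R]_l.+1)
    (A N Nbar : set 'M[R]_l.+1) : set (set 'M[R]_l.+1) :=
  \bigcup_(O in closed_orbits v (product_set A N) `|`
                closed_orbits v (product_set A Nbar)) O.

(* C^infinity: every iterated directional derivative is differentiable. *)
Definition smooth (R : realType) (l : nat) (F : 'M[R]_l.+1 -> R) : Prop :=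
  forall (s : seq 'M[R]_l.+1) (x : 'M[R]_l.+1),
    differentiable
      (foldr (fun (u : 'M[R]_l.+1) (E : 'M[R]_l.+1 -> R) => 'D_u E) F s) x.

(* f is smooth on G/H: f \o AdS_proj is smooth on G, i.e. extends locally to a
   smooth function of matrices; values of f off AdS are irrelevant. *)
Definition smooth_AdS (R : realType) (l : nat) (v : 'cV[R]_l.+1)
    (f : set 'M[R]_l.+1 -> R) : Prop :=
  forall g, SO2 R l g ->
    exists2 F : 'M[R]_l.+1 -> R, smooth F &
      \forall h \near g, SO2 R l h -> f (AdS_proj v h) = F h.

(* Tangent vectors are represented by their action on smooth functions. *)
Definition tangent (R : realType) (l : nat) (v : 'cV[R]_l.+1) : Type :=
  {f : set 'M[R]_l.+1 -> R | smooth_AdS v f} -> R.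

Definition velocity (R : realType) (l : nat) (v : 'cV[R]_l.+1)
    (c : R -> set 'M[R]_l.+1) : tangent v :=
  fun f => derive1 (fun t : R => sval f (c t)) 0.
Arguments velocity {R l} v c _.

Definition fundamental_field (R : realType) (l : nat) (v : 'cV[R]_l.+1)
    (X g : 'M[R]_l.+1) : tangent v :=
  velocity v (fun t => AdS_proj v (expm (- t *: X) *m g)).
Arguments fundamental_field {R l} v X g _.

(* Square norm of the tangent vector w at p for the G-invariant metric: w is
   the image under the left translation by g of the vector of T_[e] that
   corresponds to X in q, where p = [g], and its square norm is that of X. *)
Definition metric_sqnorm (R : realType) (l : nat) (v : 'cV[R]_l.+1)
    (gg qq : {vspace 'M[R]_l.+1}) (p : set 'M[R]_l.+1) (w : tangent v) : R :=
  xget 0 [set r | exists g X,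
    [/\ SO2 R l g, p = AdS_proj v g, X \in qq,
        w = velocity v (fun t => AdS_proj v (g *m expm (t *: X)))
      & r = sqnorm gg X]].

(* Main.v *)
(* Write <x, y> for the form, identify [g] with x = g v, so that AdS is the quadric
   <x, x> = 1, and let wedge a b be the map x |-> <b, x> a - <a, x> b. Since B is
   (l - 1) times the trace form, q consists of the wedge w v and the square norm
   of X in q is <X v, X v>; hence |J1^*| at [g] is <J1 x, J1 x>. A root vector X of
   weight (1, 1), together with the fact that [X, theta X] lies in a by maximality,
   forces J2 = wedge w v with <w, w> = -1 and J1 = wedge u u' with u, u' null,
   <u, u'> = 1 and u, u' orthogonal to v, w. So <J1 x, J1 x> = -2 <u, x> <u', x>.
   The group AN scales <x, u> by positive factors. Where <x, u> is not 0, an orbit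
   is a whole half {<x, u> > 0} or {<x, u> < 0}, which accumulates on v; where
   <x, u> = 0, the signature gives <x, v + w> <> 0 and the orbits are cut out by
   the sign of <x, v + w>, hence closed. Exchanging (J1, J2, u, u', w) with
   (-J1, -J2, u', u, -w) gives the same for A Nbar and u'. *)

Require Import Defs.
From HB Require Import structures.
From mathcomp Require Import all_boot all_order all_algebra.
From mathcomp Require Import all_classical all_reals all_analysis.
From mathcomp Require Import ring lra.

Set Implicit Arguments.
Unset Strict Implicit.
Unset Printing Implicit Defensive.

Import Order.TTheory GRing.Theory Num.Theory.
Import numFieldNormedType.Exports.

Local Open Scope classical_set_scope.
Local Open Scope ring_scope.

(** * The matrix exponential *)

(** The algebras g and h, the involutions and [J1], [J2] are known only through their properties, so
    no explicit matrices are available; all computations rest on the Gram matrix of a few vectors.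
    Two facts make this possible: exp (t X) stays in G for all t exactly when X is skew for the
    form, and h and q are orthogonal for B because sigma preserves B. The set AN enters as a mere
    set of products. It is bounded from above by a group that preserves an isotropic flag with
    positive scalings, which supplies the invariants of orbits, and from below by exponentials of
    elements wedge u y and wedge (v + w) y of n, which supply transitivity. Tangent vectors act on
    functions and the metric is defined by a choice, so independence of that choice is proved as
    well, by testing on the coordinates of g v. *)

Lemma cvg_mxP (R : realFieldType) (m n : nat) (T : Type) (F : set_system T)
    (FF : Filter F) (f : T -> 'M[R]_(m, n)) (A : 'M[R]_(m, n)) :
  f @ F --> A <-> forall i j, (fun t => f t i j) @ F --> A i j.
Proof.
split=> [fA i j|fA].
  by apply: (@cvg_comp _ _ _ f (fun M : 'M[R]_(m, n) => M i j) _ _ _ fA);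
    exact: coord_continuous.
apply/cvgrPdist_le => e e0; near=> t.
rewrite /Num.Def.normr/= mx_normrE (bigmax_le _ (ltW e0))//= => i _.
rewrite !mxE; move: i; near: t; apply: filter_forall => /= i.
exact: ((cvgrPdist_le _ _).1 (fA i.1 i.2)).
Unshelve. all: by end_near. Qed.

Lemma cvg_mulmx (R : realFieldType) (m n p : nat) (T : Type) (F : set_system T)
    (FF : Filter F) (f : T -> 'M[R]_(m, n)) (g : T -> 'M[R]_(n, p))
    (A : 'M[R]_(m, n)) (B : 'M[R]_(n, p)) :
  f @ F --> A -> g @ F --> B -> (fun t => f t *m g t) @ F --> A *m B.
Proof.
move=> /cvg_mxP fA /cvg_mxP gB; apply/cvg_mxP => i j; rewrite mxE.
rewrite (_ : (fun t => _) = fun t => \sum_k f t i k * g t k j); last first.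
  by apply/funext => t; rewrite mxE.
apply: (@cvg_big _ _ +%R 0 xpredT (@add_continuous R)) => k _.
by apply: cvgM; [exact: fA|exact: gB].
Qed.

Section MatrixExponential.
Variables (R : realType) (l : nat).
Implicit Types (X A B : 'M[R]_l.+1) (t : R).

(** Coefficients of the scalar power series in t of an entry of A exp (t X) B. The outer factors let
    images of vectors, conjugates and derivatives be instances of one series: differentiation
    replaces A by A X. *)
Definition exp_coef m p (A : 'M[R]_(m, l.+1)) X (B : 'M[R]_(l.+1, p)) i j
    (k : nat) : R := (k`!%:R)^-1 * (A *m X ^+ k *m B) i j.

Lemma normr_mx_entry m p (A : 'M[R]_(m, p)) i j : `|A i j| <= `|A|.
Proof.
by rewrite [leRHS]/Num.Def.normr/= mx_normrE; exact: (le_bigmax _ _ (i, j)).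
Qed.

Lemma normr_mulmx_entry m p q (A : 'M[R]_(m, p)) (B : 'M[R]_(p, q)) a b :
  (forall i j, `|A i j| <= a) -> (forall i j, `|B i j| <= b) ->
  forall i j, `|(A *m B) i j| <= p%:R * a * b.
Proof.
move=> ha hb i j; rewrite mxE (le_trans (ler_norm_sum _ _ _))//.
apply: (@le_trans _ _ (\sum_(k < p) a * b)).
  by apply: ler_sum => k _; rewrite normrM ler_pM.
by rewrite sumr_const card_ord -mulrA mulr_natl.
Qed.

Lemma normr_exp_entry X k i j : `|(X ^+ k) i j| <= (l.+1%:R * `|X|) ^+ k.
Proof.
elim: k i j => [|k IH] i j.
  by rewrite !expr0 mxE; case: eqP => _; rewrite ?normr1 ?normr0.
by rewrite !exprS; exact: (normr_mulmx_entry (normr_mx_entry X) IH).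
Qed.

(** Each matrix product costs a factor [l.+1] in the sup norm, so the series is dominated by C times
    the real exponential series at K |t|. *)
Lemma is_cvg_exp_coef m p (A : 'M[R]_(m, l.+1)) X (B : 'M[R]_(l.+1, p)) i j t :
  cvgn (pseries (exp_coef A X B i j) t).
Proof.
apply: normed_cvg.
set K := l.+1%:R * `|X|; set C := l.+1%:R * (l.+1%:R * `|A|) * `|B|.
have C0 : 0 <= C by rewrite /C !mulr_ge0.
have K0 : 0 <= K by rewrite /K !mulr_ge0.
apply: (@series_le_cvg _ _ (fun k => C * exp_coeff (K * `|t|) k)) => [k|k|k|].
- exact: normr_ge0.
- by rewrite /exp_coeff/= mulr_ge0// divr_ge0// exprn_ge0// mulr_ge0.
- rewrite /exp_coef/= !normrM [X in X * _ * _]ger0_norm ?invr_ge0// normrX.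
  rewrite [leRHS](_ : _ = k`!%:R^-1 * (C * K ^+ k) * `|t| ^+ k); last first.
    by rewrite /exp_coeff/= exprMn; ring.
  rewrite ler_wpM2r ?exprn_ge0// ler_wpM2l ?invr_ge0//.
  have /= := normr_mulmx_entry (normr_mulmx_entry (normr_mx_entry A)
     (normr_exp_entry X k)) (normr_mx_entry B) i j.
  by move/le_trans; apply; rewrite /C -/K mulrA [leRHS]mulrAC !mulrA.
- by apply: (@is_cvg_seriesZ _ _ C); exact: is_cvg_series_exp_coeff.
Qed.

Lemma mulmx_series m p (A : 'M[R]_(m, l.+1)) X (B : 'M[R]_(l.+1, p)) t n i j :
  (A *m series (fun k => (k`!%:R)^-1 *: (t *: X) ^+ k) n *m B) i j =
  pseries (exp_coef A X B i j) t n.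
Proof.
rewrite /pseries /series/= mulmx_sumr mulmx_suml summxE; apply: eq_bigr => k _.
by rewrite exprZn -!scalemxAr -!scalemxAl scalerA mxE /exp_coef mulrAC.
Qed.

Lemma cvg_expm X :
  series (fun k => (k`!%:R)^-1 *: X ^+ k) @ \oo --> expm X.
Proof.
apply/cvg_ex; exists (\matrix_(i, j) limn (pseries (exp_coef 1%:M X 1%:M i j) 1)).
apply/cvg_mxP => i j; rewrite mxE.
have /cvg_ex[/= a ha] := @is_cvg_exp_coef _ _ 1%:M X 1%:M i j 1.
rewrite (cvg_lim _ ha)//; apply: cvg_trans ha; apply: near_eq_cvg.
by near=> n; rewrite -mulmx_series mul1mx mulmx1 scale1r.
Unshelve. all: by end_near. Qed.

Lemma expmE m p (A : 'M[R]_(m, l.+1)) X (B : 'M[R]_(l.+1, p)) t i j :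
  (A *m expm (t *: X) *m B) i j = limn (pseries (exp_coef A X B i j) t).
Proof.
apply/esym/cvg_lim => //.
rewrite (_ : pseries _ _ = fun n =>
  (A *m series (fun k => (k`!%:R)^-1 *: (t *: X) ^+ k) n *m B) i j); last first.
  by apply/funext => n; rewrite mulmx_series.
move: i j; apply/cvg_mxP; apply: cvg_mulmx; last exact: cvg_cst.
by apply: cvg_mulmx; [exact: cvg_cst|exact: cvg_expm].
Qed.

Lemma cvg_expm_entry m p (A : 'M[R]_(m, l.+1)) X (B : 'M[R]_(l.+1, p)) i j :
  series (exp_coef A X B i j) @ \oo --> (A *m expm X *m B) i j.
Proof.
have -> : series (exp_coef A X B i j) = pseries (exp_coef A X B i j) 1.
  by rewrite /pseries; congr series; apply/funext => k /=; rewrite expr1n mulr1.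
by rewrite -{2}[X]scale1r expmE; exact: is_cvg_exp_coef.
Qed.

Lemma is_derive_expm m p (A : 'M[R]_(m, l.+1)) X (B : 'M[R]_(l.+1, p)) i j t :
  is_derive t 1 (fun t : R => (A *m expm (t *: X) *m B) i j)
    ((A *m X *m expm (t *: X) *m B) i j).
Proof.
have diffs C : pseries_diffs (exp_coef C X B i j) = exp_coef (C *m X) X B i j.
  apply/funext => k; rewrite /pseries_diffs /exp_coef exprS -[X * _]/(X *m _).
  by rewrite !mulmxA factS natrM invfM mulrA mulVKf.
under eq_fun do rewrite expmE; rewrite expmE -diffs.
apply: (@pseries_snd_diffs _ _ (`|t| + 1)); rewrite ?diffs;
  try exact: is_cvg_exp_coef.
by rewrite [ltRHS]ger0_norm ?addr_ge0// ltrDl.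
Qed.

(** Nilpotency is asked along the single vector x: from the third partial sum on, the series applied
    to x is constant. *)
Lemma expm_nilpotent X (x : 'cV[R]_l.+1) : X *m (X *m (X *m x)) = 0 ->
  expm X *m x = x + X *m x + 2^-1 *: (X *m (X *m x)).
Proof.
move=> X3; apply/matrixP => i j.
have := @cvg_expm_entry _ _ 1%:M X x i j; rewrite mul1mx => /cvg_lim <-//.
apply/cvg_lim => //; rewrite -(cvg_shiftn 3).
rewrite (_ : (fun n => _) = fun=> (x + X *m x + 2^-1 *: (X *m (X *m x))) i j);
  first exact: cvg_cst.
apply/funext => n; rewrite /series/= addn3 !big_nat_recl// big1 ?addr0 => [|k _].
  rewrite /exp_coef !mul1mx expr1 -[X ^+ 2]/(X *m X) -mulmxA.
  set Xx := X *m x; set XXx := X *m Xx.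
  by rewrite !mxE !fact0 invr1 !mul1r addrA.
by rewrite /exp_coef mul1mx !exprSr -!mulmxA X3 mulmx0 mxE mulr0.
Qed.

Lemma expm_kernel X (x : 'cV[R]_l.+1) : X *m x = 0 -> expm X *m x = x.
Proof.
by move=> Xx; rewrite expm_nilpotent Xx !mulmx0// scaler0 !addr0.
Qed.

Lemma expm_eigen X (x : 'cV[R]_l.+1) a : X *m x = a *: x ->
  expm X *m x = expR a *: x.
Proof.
move=> Xx; apply/matrixP => i j.
have := @cvg_expm_entry _ _ 1%:M X x i j; rewrite mul1mx => /cvg_lim <-//.
apply/cvg_lim => //; rewrite mxE.
rewrite (_ : series _ = fun n => series (exp_coeff a) n * x i j); last first.
  apply/funext => n; rewrite /series/= mulr_suml; apply: eq_bigr => k _.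
  rewrite /exp_coef mul1mx.
  have -> : X ^+ k *m x = a ^+ k *: x.
    elim: k => [|k IH]; first by rewrite !expr0 mul1mx scale1r.
    by rewrite exprS -mulmxA IH -scalemxAr Xx scalerA exprSr.
  by rewrite mxE /exp_coeff/= mulrA [a ^+ k / _]mulrC.
by apply: cvgM; [exact: is_cvg_series_exp_coeff|exact: cvg_cst].
Qed.

Lemma expm_conj g X : g \in unitmx ->
  expm (g *m X *m invmx g) = g *m expm X *m invmx g.
Proof.
move=> gu; apply/matrixP => i j.
have /cvg_lim <-// := @cvg_expm_entry _ _ g X (invmx g) i j.
have := @cvg_expm_entry _ _ 1%:M (g *m X *m invmx g) 1%:M i j.
rewrite mul1mx mulmx1 => /cvg_lim <-//; congr (limn (series _)).
apply/funext => k; rewrite /exp_coef mul1mx mulmx1; congr (_ * fun_of_matrix _ _ _).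
elim: k => [|k IH]; first by rewrite !expr0 mulmx1 mulmxV.
by rewrite exprS -mulmxE IH exprS -mulmxE !mulmxA mulmxKV.
Qed.

Lemma expm0 : expm (0 : 'M[R]_l.+1) = 1%:M.
Proof.
apply/matrixP => i j; have -> : expm 0 i j = col j (expm (0 : 'M[R]_l.+1)) i 0.
  by rewrite mxE.
by rewrite colE expm_kernel ?mul0mx// !mxE eqxx andbT.
Qed.

End MatrixExponential.

(** * The bilinear form and infinitesimal isometries *)

Section BilinearForm.
Variables (R : realType) (l : nat).
Implicit Types (X Y g h : 'M[R]_l.+1) (x y z a b : 'cV[R]_l.+1).
Local Notation eta := (form_mx R l).

Lemma mulmx_cV_inj X Y : (forall x, X *m x = Y *m x) -> X = Y.
Proof.
move=> XY; apply/matrixP => i j.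
by have := congr1 (fun M : 'cV_l.+1 => M i 0) (XY (delta_mx j 0));
  rewrite -!colE !mxE.
Qed.

Lemma mx_bilin_inj X Y :
  (forall x y, (x^T *m X *m y) 0 0 = (x^T *m Y *m y) 0 0) -> X = Y.
Proof.
move=> XY; apply/matrixP => i j; have := XY (delta_mx i 0) (delta_mx j 0).
by rewrite trmx_delta -!rowE -!colE !mxE.
Qed.

Lemma form_mxT : eta^T = eta. Proof. exact: tr_diag_mx. Qed.

Lemma form_mxK : eta *m eta = 1%:M.
Proof.
apply/matrixP => i j; rewrite mul_diag_mx !mxE.
by case: (i < 2)%N; rewrite ?mulN1r ?mul1r// mulNrn opprK.
Qed.

Lemma form_mx_unit : eta \in unitmx.
Proof. by case: (mulmx1_unit form_mxK). Qed.

Lemma bilin_formE x y : x^T *m eta *m y = (bilin_form x y)%:M.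
Proof. exact: mx11_scalar. Qed.

Lemma bilin_formC x y : bilin_form x y = bilin_form y x.
Proof.
rewrite /bilin_form; transitivity ((x^T *m eta *m y)^T 0 0); first by rewrite [RHS]mxE.
by rewrite !trmx_mul trmxK form_mxT mulmxA.
Qed.

Lemma bilin_formDr x y z : bilin_form x (y + z) = bilin_form x y + bilin_form x z.
Proof. by rewrite /bilin_form mulmxDr mxE. Qed.

Lemma bilin_formDl x y z : bilin_form (y + z) x = bilin_form y x + bilin_form z x.
Proof. by rewrite bilin_formC bilin_formDr !(bilin_formC x). Qed.

Lemma bilin_formZr x y c : bilin_form x (c *: y) = c * bilin_form x y.
Proof. by rewrite /bilin_form -scalemxAr mxE. Qed.

Lemma bilin_formZl x y c : bilin_form (c *: y) x = c * bilin_form y x.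
Proof. by rewrite bilin_formC bilin_formZr bilin_formC. Qed.

Lemma bilin_formNr x y : bilin_form x (- y) = - bilin_form x y.
Proof. by rewrite /bilin_form mulmxN mxE. Qed.

Lemma bilin_formNl x y : bilin_form (- x) y = - bilin_form x y.
Proof. by rewrite bilin_formC bilin_formNr bilin_formC. Qed.

Lemma bilin_form0r x : bilin_form x 0 = 0.
Proof. by rewrite /bilin_form mulmx0 mxE. Qed.

Lemma bilin_form0l x : bilin_form 0 x = 0.
Proof. by rewrite bilin_formC bilin_form0r. Qed.

Definition bilin_formL := (bilin_formDr, bilin_formDl, bilin_formNr,
  bilin_formNl, bilin_formZr, bilin_formZl, bilin_form0r, bilin_form0l).

Lemma bilin_form_eq0 x : (forall y, bilin_form x y = 0) -> x = 0.
Proof.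
move=> x0; apply: trmx_inj; apply: (can_inj (mulmxK form_mx_unit)).
rewrite /= trmx0 mul0mx; apply/matrixP => i j; rewrite [i]ord1 [RHS]mxE.
by have := x0 (delta_mx j 0); rewrite /bilin_form -colE mxE.
Qed.

Lemma bilin_form_neq0 x : x != 0 -> exists y, bilin_form x y != 0.
Proof.
move=> x0; apply/not_existsP => h; move/eqP: x0; apply; apply: bilin_form_eq0.
by move=> y; apply/eqP/negPn/negP; exact: h.
Qed.

Lemma bilin_form_sum x y : bilin_form x y =
  \sum_(i < l.+1) (if (i < 2)%N then 1 else -1) * (x i 0 * y i 0).
Proof.
rewrite /bilin_form mul_mx_diag mxE; apply: eq_bigr => i _; rewrite !mxE; ring.
Qed.

Definition skew X := forall x y, bilin_form (X *m x) y = - bilin_form x (X *m y).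

Lemma skewP X : skew X <-> X^T *m eta = - (eta *m X).
Proof.
split=> [sX|XE x y].
  apply: mx_bilin_inj => x y; rewrite mulmxN mulNmx [RHS]mxE.
  by have := sX x y; rewrite /bilin_form trmx_mul !mulmxA.
by rewrite /bilin_form trmx_mul -(mulmxA x^T X^T) XE mulmxN mulNmx [LHS]mxE !mulmxA.
Qed.

Definition orthogonal_mx g :=
  forall x y, bilin_form (g *m x) (g *m y) = bilin_form x y.

Lemma orthogonal_mxP g : orthogonal_mx g <-> g^T *m eta *m g = eta.
Proof.
split=> [og|gE x y].
  apply: mx_bilin_inj => x y; have := og x y.
  by rewrite /bilin_form trmx_mul !mulmxA.
by rewrite /bilin_form trmx_mul !mulmxA -(mulmxA x^T g^T) -(mulmxA x^T) gE.
Qed.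

Lemma orthogonal_mx_unit g : orthogonal_mx g -> g \in unitmx.
Proof.
move/orthogonal_mxP => gE.
have : (eta *m (g^T *m eta)) *m g = 1%:M by rewrite -!mulmxA (mulmxA g^T) gE form_mxK.
by case/mulmx1_unit.
Qed.

Lemma orthogonal_mxV g x y : orthogonal_mx g ->
  bilin_form (g *m x) y = bilin_form x (invmx g *m y).
Proof.
by move=> og; rewrite -[RHS]og mulmxA mulmxV ?mul1mx// orthogonal_mx_unit.
Qed.

Lemma skewD X Y : skew X -> skew Y -> skew (X + Y).
Proof. by move=> sX sY x y; rewrite !mulmxDl !bilin_formL sX sY opprD. Qed.

Lemma skewZ c X : skew X -> skew (c *: X).
Proof. by move=> sX x y; rewrite -!scalemxAl !bilin_formL sX mulrN. Qed.

Lemma skew_lie X Y : skew X -> skew Y -> skew (lie X Y).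
Proof.
move=> sX sY x y; rewrite /lie !mulmxBl -!mulmxA !bilin_formL !sX !sY !sX; ring.
Qed.

Lemma skew_xx X x : skew X -> bilin_form x (X *m x) = 0.
Proof. by move=> sX; have := sX x x; rewrite bilin_formC; lra. Qed.

Definition wedge a b : 'M[R]_l.+1 := a *m (b^T *m eta) - b *m (a^T *m eta).

Lemma wedgeE a b x :
  wedge a b *m x = bilin_form b x *: a - bilin_form a x *: b.
Proof.
by rewrite /wedge mulmxBl -!mulmxA (mulmxA b^T) (mulmxA a^T) !bilin_formE
  !mul_mx_scalar.
Qed.

Lemma skew_wedge a b : skew (wedge a b).
Proof.
move=> x y; rewrite !wedgeE !bilin_formL (bilin_formC x a) (bilin_formC x b).
ring.
Qed.

Lemma wedgeC a b : wedge a b = - wedge b a.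
Proof. by rewrite /wedge opprB. Qed.

Lemma wedgexx a : wedge a a = 0.
Proof. exact: subrr. Qed.

Lemma wedgeDr a b c : wedge a (b + c) = wedge a b + wedge a c.
Proof.
apply: mulmx_cV_inj => x; rewrite [RHS]mulmxDl !wedgeE !bilin_formL.
by apply/matrixP => i j; rewrite !mxE; ring.
Qed.

Lemma wedgeZr k a b : wedge a (k *: b) = k *: wedge a b.
Proof.
apply: mulmx_cV_inj => x; rewrite -[RHS]scalemxAl !wedgeE !bilin_formL.
by apply/matrixP => i j; rewrite !mxE; ring.
Qed.

(** A skew matrix acts on wedges as a derivation, as in the identification of the Lie algebra with
    the second exterior power. *)
Lemma lie_wedge X a b : skew X ->
  lie X (wedge a b) = wedge (X *m a) b + wedge a (X *m b).
Proof.
move=> sX; apply: mulmx_cV_inj => x.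
rewrite /lie mulmxBl -(mulmxA X) -(mulmxA _ X) [RHS]mulmxDl !wedgeE.
rewrite mulmxBr -!scalemxAr !sX !scaleNr.
by rewrite opprB opprK addrACA; congr (_ + _); rewrite addrC.
Qed.

End BilinearForm.

(** * The groups G and H and the points of AdS *)

Section Groups.
Variables (R : realType) (l : nat).
Implicit Types (X Y g h : 'M[R]_l.+1) (x y v : 'cV[R]_l.+1).
Local Notation eta := (form_mx R l).

Lemma is_derive_expm_entry X (t : R) i j :
  is_derive t 1 (fun t : R => expm (t *: X) i j) ((X *m expm (t *: X)) i j).
Proof.
have := is_derive_expm 1%:M X 1%:M i j t.
rewrite mulmx1 mul1mx; under [X in is_derive _ _ X _ -> _]eq_fun do rewrite mulmx1 mul1mx.
by [].
Qed.

Lemma continuous_expm X : continuous (fun t : R => expm (t *: X)).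
Proof.
move=> t; apply/cvg_mxP => i j; apply: differentiable_continuous.
by apply/derivable1_diffP; have [] := is_derive_expm_entry X t i j.
Qed.

(** The derivative carries the defect X^T eta + eta X in the middle. It vanishes for skew X, so the
    Gram matrix stays constant; conversely, its value at 0 shows that a constant Gram matrix makes X
    skew. *)
Lemma is_derive_expm_form X (t : R) i j :
  is_derive t 1 (fun t : R => ((expm (t *: X))^T *m eta *m expm (t *: X)) i j)
   (((expm (t *: X))^T *m (X^T *m eta + eta *m X) *m expm (t *: X)) i j).
Proof.
pose h k (t : R) := expm (t *: X) k i * (eta *m expm (t *: X)) k j.
rewrite (_ : (fun t => _) = \sum_k h k); last first.
  apply/funext => s; rewrite fct_sumE -mulmxA mxE.
  by apply: eq_bigr => k _; rewrite /h mxE.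
rewrite (_ : fun_of_matrix _ i j = \sum_k
  (expm (t *: X) k i *: (eta *m X *m expm (t *: X)) k j +
   (eta *m expm (t *: X)) k j *: (X *m expm (t *: X)) k i)); last first.
  rewrite big_split/= mulmxDr mulmxDl mxE addrC; congr (_ + _).
    by rewrite -mulmxA mxE; apply: eq_bigr => k _; rewrite [_^T _ _]mxE.
  rewrite !mulmxA -trmx_mul -mulmxA mxE; apply: eq_bigr => k _.
  by rewrite [_^T _ _]mxE mulrC.
apply: is_derive_sum => k; apply: is_deriveM.
  exact: is_derive_expm_entry.
have := is_derive_expm eta X 1%:M k j t.
by rewrite mulmx1; under [X in is_derive _ _ X _ -> _]eq_fun do rewrite mulmx1.
Qed.

Lemma orthogonal_expm X : skew X -> forall t : R, orthogonal_mx (expm (t *: X)).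
Proof.
move=> /skewP sX t; apply/orthogonal_mxP/matrixP => i j.
have d0 (s : R) : is_derive s 1
    (fun t : R => ((expm (t *: X))^T *m eta *m expm (t *: X)) i j) 0.
  have := is_derive_expm_form X s i j.
  by rewrite sX addNr mulmx0 mul0mx [X in is_derive _ _ _ X -> _]mxE.
rewrite [LHS](is_derive_0_is_cst t 0 d0).
by rewrite scale0r expm0 trmx1 mul1mx mulmx1.
Qed.

Lemma skew_expm X : (forall t : R, orthogonal_mx (expm (t *: X))) -> skew X.
Proof.
move=> oX; apply/skewP/eqP; rewrite -addr_eq0; apply/eqP/matrixP => i j.
have := is_derive_expm_form X 0 i j.
rewrite scale0r expm0 trmx1 mul1mx mulmx1 => -[_ <-].
under eq_fun do rewrite (orthogonal_mxP _).1//.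
by rewrite derive_cst mxE.
Qed.

Lemma continuous_det : continuous (fun g => \det g).
Proof.
have cprod (s : 'I_l.+1 -> 'I_l.+1) : continuous (fun g : 'M[R]_l.+1 => \prod_i g i (s i)).
  apply: (@continuous_big R 'I_l.+1 *%R 1 xpredT (@mul_continuous R) _
    (index_enum 'I_l.+1) (fun i (g : 'M[R]_l.+1) => g i (s i))) => i _.
  exact: coord_continuous.
apply: (@continuous_big _ _ +%R 0 xpredT (@add_continuous R)) => s _ g.
apply: cvgMl_tmp; [exact: nbhs_filter g|exact: cprod].
Qed.

Lemma det_orthogonal g : orthogonal_mx g -> \det g ^+ 2 = 1.
Proof.
move=> /orthogonal_mxP/(congr1 determinant); rewrite !det_mulmx det_tr => E.
have eta0 : \det eta != 0 by rewrite -unitfE -unitmxE form_mx_unit.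
by apply: (mulfI eta0); rewrite mulr1 -[RHS]E; ring.
Qed.

(** The determinant of an orthogonal matrix is 1 or -1. Along s |-> exp (s t X) it is continuous and
    equals 1 at s = 0; the value -1 at s = 1 would force a zero in between. *)
Lemma det_expm X : skew X -> forall t : R, \det (expm (t *: X)) = 1.
Proof.
move=> sX t; pose f (s : R) := \det (expm ((s * t) *: X)).
have f2 s : f s ^+ 2 = 1.
  by rewrite /f det_orthogonal//; exact: orthogonal_expm.
have cf : continuous f.
  rewrite (_ : f = fun s => \det (expm (s *: (t *: X)))); last first.
    by apply/funext => s; rewrite /f scalerA.
  move=> s; exact: (cvg_comp _ _ (@continuous_expm (t *: X) s) (@continuous_det _)).
have f0 : f 0 = 1 by rewrite /f mul0r scale0r expm0 det1.
have f1 : f 1 = \det (expm (t *: X)) by rewrite /f mul1r.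
rewrite -f1; move: (f2 1) => /eqP; rewrite sqrf_eq1 => /orP[/eqP//|/eqP f1N].
have [||c _ fc] := @IVT R f 0 1 0 ler01.
- by apply: continuous_subspaceT.
- by rewrite f0 f1N ge_min le_max lerN10 ler01 orbT.
- by have := f2 c; rewrite fc expr0n => /eqP; rewrite eq_sym oner_eq0.
Qed.

Lemma special_orthogonalP g :
  special_orthogonal R l g <-> orthogonal_mx g /\ \det g = 1.
Proof. by split=> -[/orthogonal_mxP]. Qed.

Lemma SO2_orthogonal g : SO2 R l g -> orthogonal_mx g.
Proof. by move=> /connected_component_sub/special_orthogonalP[]. Qed.

Lemma SO2_unit g : SO2 R l g -> g \in unitmx.
Proof. by move=> /SO2_orthogonal/orthogonal_mx_unit. Qed.

Lemma special_orthogonalM g h : special_orthogonal R l g ->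
  special_orthogonal R l h -> special_orthogonal R l (g *m h).
Proof.
move=> /special_orthogonalP[og dg] /special_orthogonalP[oh dh].
apply/special_orthogonalP; split; last by rewrite det_mulmx dg dh mul1r.
by move=> x y; rewrite -!mulmxA og oh.
Qed.

Lemma special_orthogonalV g : special_orthogonal R l g ->
  special_orthogonal R l (invmx g).
Proof.
move=> /special_orthogonalP[og dg]; apply/special_orthogonalP; split.
  by move=> x y; rewrite -orthogonal_mxV// mulmxA mulmxV ?mul1mx// orthogonal_mx_unit.
by rewrite det_inv dg invr1.
Qed.

Lemma special_orthogonal1 : special_orthogonal R l 1%:M.
Proof. by apply/special_orthogonalP; split; [move=> x y; rewrite !mul1mx|exact: det1]. Qed.

Lemma connected_mulmx g (C : set 'M[R]_l.+1) :
  connected C -> connected (mulmx g @` C).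
Proof.
move=> cC; apply: connected_continuous_connected => //.
apply: continuous_subspaceT => x.
exact: (cvg_mulmx (nbhs_filter x) (cvg_cst g) cvg_id).
Qed.

(** Left translation by an element of the special orthogonal group is continuous and preserves that
    group, so it moves connected sets through 1 to connected sets joining the required points. *)
Lemma SO2_subgroup : is_subgroup (SO2 R l).
Proof.
split.
- by apply: connected_component_refl; exact: special_orthogonal1.
- move=> g h hg [C [C1 CS Cc] Ch]; apply: (connected_component_trans hg).
  exists (mulmx g @` C); last by exists h.
  split; last exact: connected_mulmx.
    by exists 1%:M => //; rewrite mulmx1.
  move=> _ [k Ck <-]; apply: special_orthogonalM; last exact: CS.
  exact: connected_component_sub hg.
- move=> g hg; have [C [C1 CS Cc] Cg] := hg.
  exists (mulmx (invmx g) @` C); last by exists 1%:M => //; rewrite mulmx1.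
  split; last exact: connected_mulmx.
    by exists g => //; rewrite mulVmx// SO2_unit.
  move=> _ [k Ck <-]; apply: special_orthogonalM; last exact: CS.
  exact/special_orthogonalV/CS.
Qed.

Lemma SO2_1 : SO2 R l 1%:M. Proof. by case: SO2_subgroup. Qed.

Lemma SO2_M g h : SO2 R l g -> SO2 R l h -> SO2 R l (g *m h).
Proof. by have [_ + _] := SO2_subgroup; exact. Qed.

Lemma SO2_V g : SO2 R l g -> SO2 R l (invmx g).
Proof. by have [_ _] := SO2_subgroup; exact. Qed.

Lemma SO2_expm X (t : R) : skew X -> SO2 R l (expm (t *: X)).
Proof.
move=> sX; exists (range (fun s : R => expm (s *: X))); last by exists t.
split.
- by exists 0 => //; rewrite scale0r expm0.
- move=> _ [s _ <-]; apply/special_orthogonalP; split.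
    exact: orthogonal_expm.
  exact: det_expm.
- apply: connected_continuous_connected; last first.
    by apply: continuous_subspaceT; exact: continuous_expm.
  by apply/connected_intervalP => x y _ _ z.
Qed.

Lemma SO2_lie_algebraP X : skew X <-> forall t : R, SO2 R l (expm (t *: X)).
Proof.
split=> [sX t|hX]; first exact: SO2_expm.
by apply: skew_expm => t; exact/SO2_orthogonal/hX.
Qed.

Lemma is_derive_expm_vec X x (t : R) i :
  is_derive t 1 (fun t : R => (expm (t *: X) *m x) i 0)
    ((X *m expm (t *: X) *m x) i 0).
Proof.
have := is_derive_expm 1%:M X x i 0 t.
by rewrite mul1mx; under [X in is_derive _ _ X _ -> _]eq_fun do rewrite mul1mx.
Qed.

Lemma isotropy_lie_algebraP v X :
  (skew X /\ X *m v = 0) <-> forall t : R, isotropy v (expm (t *: X)).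
Proof.
split=> [[sX Xv] t|hX].
  by split; [exact: SO2_expm|rewrite expm_kernel// -scalemxAl Xv scaler0].
split; first by apply/SO2_lie_algebraP => t; have [] := hX t.
apply/matrixP => i j; rewrite [j]ord1.
have [_ ] := is_derive_expm_vec X v 0 i; rewrite scale0r expm0 mulmx1 => <-.
under eq_fun do rewrite (hX _).2.
by rewrite derive_cst mxE.
Qed.

(** This lets points of AdS be handled as vectors g v: two representatives with the same image of v
    differ by the element h^-1 g of the stabilizer. *)
Lemma AdS_projP v g h : SO2 R l g -> SO2 R l h ->
  AdS_proj v g = AdS_proj v h <-> g *m v = h *m v.
Proof.
move=> hg hh; split=> [E|E].
  have : AdS_proj v g g.
    by exists 1%:M; [split; [exact: SO2_1|rewrite mul1mx]|rewrite mulmx1].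
  by rewrite E => -[k [_ kv] <-]; rewrite -mulmxA kv.
wlog suff : g h hg hh E / AdS_proj v g `<=` AdS_proj v h.
  by move=> W; apply/seteqP; split; exact: W.
move=> _ [k [hk kv] <-]; exists (invmx h *m (g *m k)).
  split; first by apply: SO2_M; [exact: SO2_V|exact: SO2_M].
  by rewrite -!mulmxA kv E mulmxA mulVmx ?mul1mx// SO2_unit.
by rewrite mulmxA mulmxV ?mul1mx// SO2_unit.
Qed.

Lemma AdS_act_proj v r g : AdS_act r (AdS_proj v g) = AdS_proj v (r *m g).
Proof.
apply/seteqP; split=> [_ [_ [k hk <-] <-]|_ [k hk <-]].
  by exists k => //; rewrite mulmxA.
by exists (g *m k); [exists k|rewrite mulmxA].
Qed.

Lemma connected_subgroup_subgroup (U : {vspace 'M[R]_l.+1}) :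
  is_subgroup (connected_subgroup U).
Proof.
split=> [K [[]]//|x y hx hy K KU|x hx K KU].
  by have [[_ + _] _] := KU; apply; [exact: hx|exact: hy].
by have [[_ _ +] _] := KU; apply; exact: hx.
Qed.

Lemma connected_subgroup_expm (U : {vspace 'M[R]_l.+1}) X :
  X \in U -> connected_subgroup U (expm X).
Proof. by move=> XU; apply: sub_gen_smallest; exists X. Qed.

Lemma connected_subgroup_sub (U : {vspace 'M[R]_l.+1}) K :
  is_subgroup K -> (forall X, X \in U -> K (expm X)) ->
  connected_subgroup U `<=` K.
Proof. by move=> sK UK; apply: smallest_sub => // _ [X XU <-]; exact: UK. Qed.

End Groups.

(** * The Killing form *)

Section LinearTrace.
Variables (R : realType) (l : nat).
Local Notation M := 'M[R]_l.+1.
Implicit Types (U : {vspace M}) (f g : 'End(M)).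

Definition ltrace U f : R :=
  \sum_(i < \dim U) coord (vbasis U) i (f (vbasis U)`_i).

Lemma vbasis_nth U (i : 'I_(\dim U)) : (vbasis U)`_i \in U.
Proof. by apply: vbasis_mem; apply: mem_nth; rewrite size_tuple. Qed.

Lemma eq_ltrace U f g : {in U, f =1 g} -> ltrace U f = ltrace U g.
Proof. by move=> fg; apply: eq_bigr => i _; rewrite fg// vbasis_nth. Qed.

Lemma ltraceC U f g : (forall X, X \in U -> f X \in U) ->
  (forall X, X \in U -> g X \in U) -> ltrace U (f \o g) = ltrace U (g \o f).
Proof.
have E f' g' : (forall X, X \in U -> g' X \in U) ->
    ltrace U (f' \o g') = \sum_(i < \dim U) \sum_(j < \dim U)
    coord (vbasis U) j (g' (vbasis U)`_i) * coord (vbasis U) i (f' (vbasis U)`_j).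
  move=> g'U; apply: eq_bigr => i _; rewrite comp_lfunE.
  rewrite [in LHS](coord_vbasis (g'U _ (vbasis_nth i))) !linear_sum.
  by apply: eq_bigr => j _; rewrite !linearZ.
move=> fU gU; rewrite !E// exchange_big; apply: eq_bigr => i _.
by apply: eq_bigr => j _; rewrite mulrC.
Qed.

(** The map f \o P sends every matrix into U and agrees with f on U, so its trace on the whole
    matrix space, read off in the basis of matrix units, is the trace of f on U. *)
Lemma ltrace_proj U f (P : {linear M -> M}) : (forall X, P X \in U) ->
  {in U, forall X, P X = X} -> (forall X, X \in U -> f X \in U) ->
  ltrace U f = \sum_i \sum_j (f (P (delta_mx i j))) i j.
Proof.
move=> PU Pid fU.
transitivity (\sum_i \sum_j \sum_(k < \dim U)
    (f (vbasis U)`_k) i j * coord (vbasis U) k (P (delta_mx i j))).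
  under eq_bigr do rewrite exchange_big.
  rewrite exchange_big; apply: eq_bigr => k _.
  have fk : f (vbasis U)`_k \in U by rewrite fU ?vbasis_nth.
  rewrite -{1}(Pid _ fk) {1}[f _]matrix_sum_delta !linear_sum.
  apply: eq_bigr => i _; rewrite !linear_sum; apply: eq_bigr => j _.
  by rewrite !linearZ.
apply: eq_bigr => i _; apply: eq_bigr => j _.
rewrite [in RHS](coord_vbasis (PU (delta_mx i j))) linear_sum summxE.
by apply: eq_bigr => k _; rewrite linearZ mxE mulrC.
Qed.

End LinearTrace.

Section KillingForm.
Variables (R : realType) (l : nat).
Implicit Types (X Y Z A B : 'M[R]_l.+1) (a b x y : 'cV[R]_l.+1).
Local Notation eta := (form_mx R l).

(** Half of Z minus its adjoint for the form: the projection onto skew matrices with which traces on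
    [gg] are computed without a basis of [gg]. *)
Definition skew_part Z : 'M[R]_l.+1 := 2^-1 *: (Z - eta *m Z^T *m eta).

Fact skew_part_is_linear : linear skew_part.
Proof.
move=> a Y Z; rewrite /skew_part linearP/= mulmxDr mulmxDl -scalemxAr -scalemxAl.
by rewrite opprD addrACA -scalerBr scalerDr scalerA mulrC -scalerA.
Qed.

HB.instance Definition _ := GRing.isLinear.Build R 'M[R]_l.+1 'M[R]_l.+1 *:%R
  skew_part skew_part_is_linear.

Lemma skew_tr X : skew X -> eta *m X^T *m eta = - X.
Proof.
by move=> /skewP sX; rewrite -mulmxA sX mulmxN mulmxA form_mxK mul1mx.
Qed.

Lemma skew_skew_part Z : skew (skew_part Z).
Proof.
apply/skewP; rewrite /skew_part linearZ/= -scalemxAl -scalemxAr -scalerN.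
congr (_ *: _); rewrite linearB/= !trmx_mul trmxK form_mxT mulmxBl mulmxBr opprB.
by rewrite !mulmxA form_mxK mul1mx -!mulmxA form_mxK mulmx1.
Qed.

Lemma skew_part_id X : skew X -> skew_part X = X.
Proof.
move=> /skew_tr E; rewrite /skew_part E opprK -mulr2n -[X *+ 2]scaler_nat scalerA.
by rewrite mulVf ?scale1r// pnatr_eq0.
Qed.

Lemma mxtrace_skew X : skew X -> \tr X = 0.
Proof.
move=> /skew_tr E; suff : \tr X = - \tr X by lra.
by rewrite -linearN/= -E mxtrace_mulC mulmxA form_mxK mul1mx mxtrace_tr.
Qed.

Lemma mul_delta_mulmx A B i j (a b : 'I_l.+1) : (A *m delta_mx i j *m B) a b = A a i * B j b.
Proof.
rewrite -mulmxA mxE (bigD1 i)//= big1 ?addr0 => [|k ki].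
  congr (_ * _); rewrite mxE (bigD1 j)//= big1 ?addr0 => [|k kj].
    by rewrite mxE !eqxx mul1r.
  by rewrite mxE (negPf kj) andbF mul0r.
rewrite [X in _ * X]mxE big1 ?mulr0// => j' _.
by rewrite mxE (negPf ki) mul0r.
Qed.

(** The left side is the trace of the operator Z |-> A Z B; in the next lemma it is that of Z |-> A
    Z^T B. *)
Lemma sum_mul_delta A B :
  \sum_i \sum_j (A *m delta_mx i j *m B) i j = \tr A * \tr B.
Proof.
rewrite mulr_suml; apply: eq_bigr => i _; rewrite mulr_sumr.
by apply: eq_bigr => j _; rewrite mul_delta_mulmx.
Qed.

Lemma sum_mul_tr_delta A B :
  \sum_i \sum_j (A *m (delta_mx i j)^T *m B) i j = \tr (A *m B^T).
Proof.
apply: eq_bigr => i _; rewrite mxE.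
by apply: eq_bigr => j _; rewrite trmx_delta mul_delta_mulmx [B^T _ _]mxE.
Qed.

Variable gg : {vspace 'M[R]_l.+1}.
Hypothesis ggP : forall X, X \in gg <-> skew X.

Lemma ad_stable X Y : X \in gg -> Y \in gg -> ad X Y \in gg.
Proof. by rewrite adE => /ggP sX /ggP sY; apply/ggP/skew_lie. Qed.

Lemma killingE X Y : killing gg X Y = ltrace gg (ad X \o ad Y).
Proof. by apply: eq_bigr => i _; rewrite comp_lfunE. Qed.

(** Expand ad X (ad Y Z) into the four terms of L and compose with [skew_part]. On Z they contribute
    2 (l + 1) tr (X Y), since skew matrices are traceless; on the adjoint of Z they contribute 4 tr
    (X Y). Half the difference is (l - 1) tr (X Y). *)
Lemma killing_mxtrace X Y : X \in gg -> Y \in gg ->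
  killing gg X Y = (l%:R - 1) * \tr (X *m Y).
Proof.
move=> Xg Yg; rewrite killingE (@ltrace_proj _ _ _ _ skew_part); first last.
- by move=> Z Zg; rewrite comp_lfunE; do 2! apply: ad_stable => //.
- by move=> Z /ggP; exact: skew_part_id.
- by move=> Z; apply/ggP; exact: skew_skew_part.
have {Xg Yg}[sX sY] : skew X /\ skew Y by split; apply/ggP.
pose L Z := X *m Y *m Z *m 1%:M - X *m Z *m Y - Y *m Z *m X + 1%:M *m Z *m (Y *m X).
have adL Z : (ad X \o ad Y)%VF Z = L Z.
  rewrite comp_lfunE !adE /L /lie mulmxBr mulmxBl !mulmxA mulmx1 mul1mx.
  by rewrite opprB addrA addrAC.
have -> : \sum_i \sum_j ((ad X \o ad Y)%VF (skew_part (delta_mx i j))) i j =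
    2^-1 * (\sum_i \sum_j (L (delta_mx i j)) i j -
     \sum_i \sum_j (L (eta *m (delta_mx i j)^T *m eta)) i j).
  rewrite mulrBr !mulr_sumr -sumrB; apply: eq_bigr => i _.
  rewrite !mulr_sumr -sumrB; apply: eq_bigr => j _.
  by rewrite /skew_part linearZ/= linearB/= !adL !mxE mulrBr.
have sumL (F : 'I_l.+1 -> 'I_l.+1 -> 'M[R]_l.+1) :
    \sum_i \sum_j (L (F i j)) i j =
    \sum_i \sum_j (X *m Y *m F i j *m 1%:M) i j -
    \sum_i \sum_j (X *m F i j *m Y) i j - \sum_i \sum_j (Y *m F i j *m X) i j +
    \sum_i \sum_j (1%:M *m F i j *m (Y *m X)) i j.
  rewrite -!sumrB -big_split; apply: eq_bigr => i _ /=.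
  by rewrite -!sumrB -big_split; apply: eq_bigr => j _ /=; rewrite /L !mxE.
have sum_tr A B : \sum_i \sum_j (A *m (eta *m (delta_mx i j)^T *m eta) *m B) i j =
    \tr (A *m eta *m B^T *m eta).
  under eq_bigr => i _ do under eq_bigr => j _ do rewrite !mulmxA -mulmxA.
  by rewrite sum_mul_tr_delta trmx_mul form_mxT mulmxA.
rewrite !sumL !sum_mul_delta !sum_tr !mxtrace1 !(mxtrace_skew sX) !(mxtrace_skew sY).
have flip Z W : skew W -> \tr (Z *m eta *m W^T *m eta) = - \tr (Z *m W).
  move=> sW; rewrite -!mulmxA (mulmxA eta) skew_tr//.
  by rewrite mulmxN linearN.
rewrite (flip _ _ sX) (flip _ _ sY) trmx1 mulmx1 -mulmxA form_mxK mulmx1 mul1mx.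
rewrite [\tr (eta *m _ *m eta)]mxtrace_mulC mulmxA form_mxK mul1mx mxtrace_tr.
by rewrite (mxtrace_mulC Y X) -natr1; field.
Qed.

Section InvolutiveAutomorphism.
Variable sigma : 'End('M[R]_l.+1).
Hypothesis sigmaP : is_involutive_automorphism gg sigma.

(** On [gg] the operator ad (sigma X) is sigma (ad X) sigma, so both sides are traces of conjugate
    operators. *)
Lemma killing_automorphism X Y : X \in gg -> Y \in gg ->
  killing gg (sigma X) (sigma Y) = killing gg X Y.
Proof.
move=> Xg Yg; have [sg ss sl] := sigmaP; rewrite !killingE.
pose f := (ad X \o ad Y \o sigma)%VF.
have fg Z : Z \in gg -> f Z \in gg.
  by move=> Zg; rewrite !comp_lfunE; do 2! apply: ad_stable => //; exact: sg.
transitivity (ltrace gg (sigma \o f)).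
  apply: eq_ltrace => Z Zg; rewrite !comp_lfunE/= !adE !sl ?ss//; first exact: sg.
  by rewrite -adE ad_stable// sg.
rewrite ltraceC//; apply: eq_ltrace => Z Zg.
by rewrite !comp_lfunE/= ss.
Qed.

Lemma killing_opposite X Y : X \in gg -> Y \in gg ->
  sigma X = - X -> sigma Y = Y -> killing gg X Y = 0.
Proof.
move=> Xg Yg sX sY; have := killing_automorphism Xg Yg.
rewrite sX sY => E; suff : killing gg (- X) Y = - killing gg X Y by lra.
rewrite /killing -sumrN; apply: eq_bigr => i _; rewrite -linearN/=; congr (coord _ _ _).
by rewrite !(adE _ (ad Y _)) /lie mulNmx mulmxN opprK opprB addrC.
Qed.

End InvolutiveAutomorphism.

Lemma mxtrace_wedge X a b : skew X ->
  \tr (X *m wedge a b) = 2 * bilin_form b (X *m a).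
Proof.
move=> sX; have E c d : \tr (X *m (c *m (d^T *m eta))) = bilin_form d (X *m c).
  by rewrite mulmxA mxtrace_mulC bilin_formE mxtrace_scalar mulr1n.
rewrite /wedge mulmxBr linearB/= !E (bilin_formC a) sX; ring.
Qed.

End KillingForm.

(** * The symmetric pair (g, h) *)

Section SymmetricPair.
Variables (R : realType) (l : nat).
Implicit Types (X Y Z : 'M[R]_l.+1) (a b x y : 'cV[R]_l.+1).

Lemma leigenspaceP (f : 'End('M[R]_l.+1)) (c : R) X :
  X \in passmx.leigenspace f c <-> f X = c *: X.
Proof.
rewrite memv_ker !lfun_simp /= subr_eq0; split=> [/eqP//|->]; exact: eqxx.
Qed.

Lemma lieNl X Y : lie (- X) Y = - lie X Y.
Proof. by rewrite /lie mulNmx mulmxN opprK opprB addrC. Qed.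

Lemma lieC X Y : lie X Y = - lie Y X.
Proof. by rewrite /lie opprB. Qed.

Hypothesis l_gt1 : (1 < l)%N.
Variables (gg hh qq : {vspace 'M[R]_l.+1}) (v : 'cV[R]_l.+1).
Variable sigma : 'End('M[R]_l.+1).
Hypothesis ggP : forall X, X \in gg <-> skew X.
Hypothesis hhP : forall X, X \in hh <-> skew X /\ X *m v = 0.
Hypothesis sigmaP : is_involutive_automorphism gg sigma.
Hypothesis hhE : (gg :&: passmx.leigenspace sigma 1)%VS = hh.
Hypothesis qqE : qq = (gg :&: passmx.leigenspace sigma (-1))%VS.
Hypothesis vv : bilin_form v v = 1.

Lemma mem_qq X : X \in qq <-> X \in gg /\ sigma X = - X.
Proof.
rewrite qqE memv_cap; split=> [/andP[-> /leigenspaceP]|[-> /= E]].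
  by rewrite scaleN1r.
by apply/leigenspaceP; rewrite scaleN1r.
Qed.

Lemma mem_hh X : X \in hh <-> X \in gg /\ sigma X = X.
Proof.
rewrite -hhE memv_cap; split=> [/andP[-> /leigenspaceP]|[-> /= E]].
  by rewrite scale1r.
by apply/leigenspaceP; rewrite scale1r.
Qed.

Let l1_neq0 : l%:R - 1 != 0 :> R.
Proof. by rewrite subr_eq0 pnatr_eq1; case: (l) l_gt1 => [|[]]. Qed.

(** For a, b orthogonal to v, wedge a b lies in h, hence is B-orthogonal to X, which says <b, X a> =
    0. So X has no block on the complement of v and is determined by X v. *)
Lemma qq_wedge X : X \in qq -> X = wedge (X *m v) v.
Proof.
move=> /[dup] /mem_qq[Xg sX] Xq; have skX : skew X by apply/ggP.
have perp a b : bilin_form v a = 0 -> bilin_form v b = 0 ->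
    bilin_form b (X *m a) = 0.
  move=> va vb; have Yh : wedge a b \in hh.
    apply/hhP; split; first exact: skew_wedge.
    by rewrite wedgeE ![bilin_form _ v]bilin_formC va vb !scale0r subrr.
  have [Yg sY] := (mem_hh _).1 Yh.
  have := killing_opposite ggP sigmaP Xg Yg sX sY.
  rewrite (killing_mxtrace ggP)// mxtrace_wedge// => /eqP.
  by rewrite !mulf_eq0 (negPf l1_neq0) pnatr_eq0/= => /eqP.
apply: mulmx_cV_inj => x; rewrite wedgeE; apply/eqP; rewrite -subr_eq0; apply/eqP.
apply: bilin_form_eq0 => y.
(* Projection onto the complement of v, which reduces arbitrary x, y to the orthogonality just
   proved. *)
pose pr z := z - bilin_form v z *: v.
have vpr z : bilin_form v (pr z) = 0 by rewrite /pr !bilin_formL vv; ring.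
have := perp _ _ (vpr x) (vpr y).
rewrite /pr mulmxBr -scalemxAr !bilin_formL !(bilin_formC y) (skew_xx v skX).
have -> : bilin_form v (X *m x) = - bilin_form (X *m v) x by rewrite skX opprK.
by move=> <-; ring.
Qed.

(** With X = wedge (X v) v, tr (X X) is -2 <X v, X v>; the factor 2 (l - 1) in the norm cancels
    exactly. *)
Lemma sqnorm_qq X : X \in qq -> sqnorm gg X = bilin_form (X *m v) (X *m v).
Proof.
move=> Xq; have [Xg _] := (mem_qq X).1 Xq; have sX : skew X by apply/ggP.
rewrite /sqnorm (killing_mxtrace ggP)// {2}(qq_wedge Xq) mxtrace_wedge//.
by rewrite -(opprK (bilin_form v _)) -sX; field.
Qed.

(** The h-component of Y kills v, so Y v sees only the q-component. *)
Lemma daddv_pi_qq Y : Y \in gg -> daddv_pi qq hh Y *m v = Y *m v.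
Proof.
move=> Yg; have [sg ss _] := sigmaP.
have int0 : (qq :&: hh)%VS = 0%VS.
  apply/eqP; rewrite -subv0; apply/subvP => X; rewrite memv_cap memv0.
  move=> /andP[/mem_qq[_ sX] /mem_hh[_]]; rewrite sX => /eqP.
  by rewrite eq_sym -addr_eq0 -mulr2n -scaler_nat scaler_eq0 pnatr_eq0.
have Ysum : Y \in (qq + hh)%VS.
  apply/memv_addP; exists (2^-1 *: (Y - sigma Y)).
    apply/mem_qq; split; first by rewrite memvZ// memvB// sg.
    by rewrite linearZ linearB/= ss// -scalerN opprB.
  exists (2^-1 *: (Y + sigma Y)).
    apply/mem_hh; split; first by rewrite memvZ// memvD// sg.
    by rewrite linearZ linearD/= ss// addrC.
  rewrite -scalerDr addrACA addNr addr0 -mulr2n -[Y *+ 2]scaler_nat scalerA.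
  by rewrite mulVf ?scale1r// pnatr_eq0.
rewrite -{2}(daddv_pi_add int0 Ysum) mulmxDl.
by have /hhP[_ ->] := memv_pi hh qq Y; rewrite addr0.
Qed.

Lemma sqnorm_daddv_pi Y : Y \in gg ->
  sqnorm gg (daddv_pi qq hh Y) = bilin_form (Y *m v) (Y *m v).
Proof. by move=> Yg; rewrite sqnorm_qq ?memv_pi// daddv_pi_qq. Qed.

End SymmetricPair.

(** * The normal form of J1 and J2 *)

Section AdaptedFrame.
Variables (R : realType) (l : nat).
Implicit Types (X Y Z J : 'M[R]_l.+1) (a b x y u v w : 'cV[R]_l.+1).

Lemma lie_jacobi X Y Z : lie X (lie Y Z) = lie (lie X Y) Z + lie Y (lie X Z).
Proof.
rewrite /lie !mulmxBr !mulmxBl !mulmxA.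
move: (X *m Y *m Z) (X *m Z *m Y) (Y *m X *m Z) (Y *m Z *m X) (Z *m X *m Y)
  (Z *m Y *m X) => A B C D E F.
by apply/matrixP => i j; rewrite !mxE; ring.
Qed.

Lemma lieDl X Y Z : lie (X + Y) Z = lie X Z + lie Y Z.
Proof. by rewrite /lie mulmxDl mulmxDr opprD addrACA. Qed.

Lemma lieZl (c : R) X Y : lie (c *: X) Y = c *: lie X Y.
Proof. by rewrite /lie -scalemxAl -scalemxAr scalerBr. Qed.

Lemma lieDr X Y Z : lie Z (X + Y) = lie Z X + lie Z Y.
Proof. exact: linearD. Qed.

Lemma lieZr (c : R) X Y : lie Y (c *: X) = c *: lie Y X.
Proof. exact: linearZ. Qed.

Lemma lie_mulmx X Y Z x : lie X Y = Z -> X *m (Y *m x) = Z *m x + Y *m (X *m x).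
Proof. by move=> <-; rewrite /lie mulmxBl -!mulmxA subrK. Qed.

Lemma root_spaceP (gg : {vspace 'M[R]_l.+1}) J1 J2 (c d : R) X :
  X \in root_space gg J1 J2 c d <->
  [/\ X \in gg, lie J1 X = c *: X & lie J2 X = d *: X].
Proof.
rewrite !memv_cap; split=> [/andP[/andP[Xg /leigenspaceP E1] /leigenspaceP E2]|].
  by rewrite !adE in E1 E2.
by move=> [-> E1 E2]; apply/andP; split=> //=; apply/leigenspaceP; rewrite adE.
Qed.

(* The frame in which J1 = wedge u u' and J2 = wedge w v; the subalgebra n then
   preserves the isotropic flag spanned by u and v + w. *)
Definition adapted_frame v w u u' : Prop :=
  [/\ bilin_form v v = 1, bilin_form w w = -1, bilin_form v w = 0,
      bilin_form u u = 0 /\ bilin_form u' u' = 0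
    & bilin_form u u' = 1 /\
      [/\ bilin_form v u = 0, bilin_form v u' = 0, bilin_form w u = 0
        & bilin_form w u' = 0]].

Lemma adapted_frame_opp v w u u' :
  adapted_frame v w u u' -> adapted_frame v (- w) u' u.
Proof.
move=> [vv ww vw [uu u'u'] [uu' [vu vu' wu wu']]].
by split; rewrite ?bilin_formL ?opprK ?vw ?oppr0// (bilin_formC u') wu wu' !oppr0.
Qed.

Section RootVector.
Variables (v w : 'cV[R]_l.+1) (X : 'M[R]_l.+1).
Hypotheses (vv : bilin_form v v = 1) (vw : bilin_form v w = 0).
Hypotheses (sX : skew X) (JX : lie (wedge w v) X = X).
Local Notation p := (X *m v).

(** Apply [J2, X] = X to v, where J2 v = w: this gives X w = -p - <w, p> v, and pairing with w shows
    <w, p> = 0. *)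
Lemma root_vector_w : X *m w = - p.
Proof.
have := lie_mulmx v JX; rewrite !wedgeE vv (bilin_formC w v) vw.
rewrite (skew_xx v sX) !scale0r subr0 sub0r scale1r => E.
have m0 : bilin_form w p = 0.
  have := congr1 (bilin_form w) E; rewrite !bilin_formL (skew_xx w sX) addr0.
  by rewrite (bilin_formC w v) vw mulr0 oppr0.
by move: E; rewrite m0 scale0r oppr0 => /esym/eqP; rewrite addrC addr_eq0 => /eqP.
Qed.

Lemma root_vector_perp : bilin_form v p = 0 /\ bilin_form w p = 0.
Proof.
split; first exact: skew_xx.
by rewrite -[LHS]opprK -bilin_formNr -root_vector_w skew_xx// oppr0.
Qed.

(** Since X = [J2, X] and J2 has its image in the plane of v and w, X is determined by X v = p and X
    w = -p. *)
Lemma root_vector_wedge : X = wedge p (v + w).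
Proof.
apply: mulmx_cV_inj => x.
have := lie_mulmx x JX; rewrite !wedgeE => E.
have -> : X *m x = bilin_form v (X *m x) *: w - bilin_form w (X *m x) *: v -
  X *m (bilin_form v x *: w - bilin_form w x *: v) by rewrite E addrK.
rewrite mulmxBr -!scalemxAr root_vector_w.
have -> : bilin_form v (X *m x) = - bilin_form p x by rewrite sX opprK.
have -> : bilin_form w (X *m x) = bilin_form p x.
  by rewrite -[LHS]opprK -sX root_vector_w bilin_formNl opprK.
by apply/matrixP => i j; rewrite !bilin_formL !mxE; ring.
Qed.

(** J2 kills p, so [J2, X] = X applied to w reads (1 + <w, w>) p = 0. *)
Lemma root_vector_ww : X != 0 -> bilin_form w w = -1.
Proof.
move=> X0; have p0 : p != 0.
  apply/eqP => p0; move: X0; rewrite root_vector_wedge p0 /wedge.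
  by rewrite trmx0 !mul0mx mulmx0 subrr eqxx.
have := lie_mulmx w JX; rewrite root_vector_w mulmxN !wedgeE vw.
have [-> ->] := root_vector_perp; rewrite !scale0r subrr oppr0.
rewrite sub0r mulmxN -scalemxAr => /esym/eqP.
rewrite -opprD oppr_eq0 -[X in X + _]scale1r -scalerDl scaler_eq0.
by rewrite (negPf p0) orbF addrC addr_eq0 => /eqP.
Qed.

End RootVector.

Section Cartan.
Variables (gg pp aa : {vspace 'M[R]_l.+1}) (theta : 'End('M[R]_l.+1)).
Variables (v : 'cV[R]_l.+1) (J1 J2 : 'M[R]_l.+1).
Hypothesis ggP : forall X, X \in gg <-> skew X.
Hypothesis thetaP : is_cartan_involution gg theta.
Hypothesis ppE : pp = (gg :&: passmx.leigenspace theta (-1))%VS.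
Hypothesis aaP : is_maximal_abelian aa pp.
Hypothesis basisJ : basis_of aa [:: J1; J2].

Lemma mem_pp X : X \in pp <-> X \in gg /\ theta X = - X.
Proof. exact: (mem_qq ppE). Qed.

Lemma mem_aa X : X \in aa <-> exists c d : R, X = c *: J1 + d *: J2.
Proof.
have /andP[/eqP <- _] := basisJ; rewrite span_cons span_seq1; split.
  by move=> /memv_addP[_ /vlineP[c ->] [_ /vlineP[d ->] ->]]; exists c, d.
by move=> [c [d ->]]; rewrite memv_add// memvZ// memv_line.
Qed.

Lemma J_aa : J1 \in aa /\ J2 \in aa.
Proof.
split; apply/mem_aa; first by exists 1, 0; rewrite scale1r scale0r addr0.
by exists 0, 1; rewrite scale1r scale0r add0r.
Qed.

Lemma J_pp : J1 \in pp /\ J2 \in pp.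
Proof. by have [/subvP sap _ _] := aaP; have [/sap + /sap] := J_aa. Qed.

Lemma theta_root_space c d X : X \in root_space gg J1 J2 c d ->
  theta X \in root_space gg J1 J2 (- c) (- d).
Proof.
have [[tg tt tl] _] := thetaP.
move=> /root_spaceP[Xg E1 E2]; apply/root_spaceP; split; first exact: tg.
  have [/mem_pp[Jg tJ] _] := J_pp.
  by rewrite -[J1]opprK -tJ lieNl -tl// E1 linearZ scaleNr.
have [_ /mem_pp[Jg tJ]] := J_pp.
by rewrite -[J2]opprK -tJ lieNl -tl// E2 linearZ scaleNr.
Qed.

(** Adding the line of Z to [aa] keeps it abelian inside [pp], so maximality absorbs Z. *)
Lemma centralizer_aa Z : Z \in pp -> lie J1 Z = 0 -> lie J2 Z = 0 -> Z \in aa.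
Proof.
move=> Zp Z1 Z2; have [sap ab maxa] := aaP.
rewrite -(maxa (aa + <[Z]>)%VS); first exact: (subvP (addvSr aa <[Z]>%VS) _ (memv_line Z)).
- by rewrite subv_add sap -memvE.
- have ZA X : X \in aa -> lie X Z = 0.
    by move=> /mem_aa[c [d ->]]; rewrite lieDl !lieZl Z1 Z2 !scaler0 addr0.
  move=> X' Y' /memv_addP[X Xa [_ /vlineP[c ->] ->]].
  move=> /memv_addP[Y Ya [_ /vlineP[d ->] ->]].
  rewrite lieDl lieZl !lieDr !lieZr (ab _ _ Xa Ya) (ZA _ Xa) (lieC Z Y) (ZA _ Ya) /lie subrr.
  by rewrite !(scaler0, oppr0, addr0).
- exact: addvSl.
Qed.

Lemma adapted_frame_exists : bilin_form v v = 1 -> J1 *m v = 0 ->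
  J2 = wedge (J2 *m v) v -> root_space gg J1 J2 1 1 <> 0%VS ->
  exists w u u', [/\ adapted_frame v w u u', J1 = wedge u u' & J2 = wedge w v].
Proof.
move=> vv J1v J2E root11; have [[tg tt tl] tpos] := thetaP.
have [/mem_pp[J1g tJ1] /mem_pp[J2g tJ2]] := J_pp.
have sJ1 : skew J1 by apply/ggP.
have sJ2 : skew J2 by apply/ggP.
set w := J2 *m v in J2E; have vw : bilin_form v w = 0 by exact: skew_xx.
set X := vpick (root_space gg J1 J2 1 1).
have X0 : X != 0 by rewrite vpick0; apply/eqP.
have Xr : X \in root_space gg J1 J2 1 1 by exact: memv_pick.
have Yr := theta_root_space Xr; set Y := theta X in Yr.
have [Xg] := (root_spaceP _ _ _ _ _ _).1 Xr; rewrite !scale1r => X1 X2.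
have [Yg] := (root_spaceP _ _ _ _ _ _).1 Yr; rewrite !scaleN1r => Y1 Y2.
have sX : skew X by apply/ggP.
have sY : skew Y by apply/ggP.
have JX : lie (wedge w v) X = X by rewrite -J2E.
(* Weight -1 for J2 is weight 1 for -J2 = wedge (- w) v, so the facts on root vectors apply to Y
   with -w in place of w. *)
have JY : lie (wedge (- w) v) Y = Y.
  rewrite (_ : wedge (- w) v = - J2) ?lieNl ?Y2 ?opprK//.
  by rewrite J2E; apply: mulmx_cV_inj => x; rewrite mulNmx !wedgeE !bilin_formL
    scaleNr scalerN opprB opprK addrC.
have vNw : bilin_form v (- w) = 0 by rewrite bilin_formL vw oppr0.
have ww := root_vector_ww vv vw sX JX X0.
have [vp wp] := root_vector_perp vv vw sX JX.
have [vq wq] := root_vector_perp vv vNw sY JY.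
have XE := root_vector_wedge vv vw sX JX.
have YE := root_vector_wedge vv vNw sY JY.
have Y0 : Y != 0 by apply: contraNneq X0 => Y0; rewrite -(tt X Xg) -/Y Y0 linear0.
set p := X *m v in vp wp XE; set q := Y *m v in vq wq YE.
have {}wq : bilin_form w q = 0 by move: wq; rewrite bilin_formL; lra.
have J1p : J1 *m p = p by rewrite /p (lie_mulmx _ X1) J1v mulmx0 addr0.
have J1q : J1 *m q = - q by rewrite /q (lie_mulmx _ Y1) J1v mulmx0 addr0 mulNmx.
have pp0 : bilin_form p p = 0 by have := skew_xx p sJ1; rewrite J1p.
have qq0 : bilin_form q q = 0.
  by have := skew_xx q sJ1; rewrite J1q bilin_formL => /eqP; rewrite oppr_eq0 => /eqP.
have J2p : J2 *m p = 0 by rewrite J2E wedgeE vp wp !scale0r subrr.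
pose d := bilin_form p q.
have ZE : lie X Y = 2 *: (wedge q p - d *: J2).
  rewrite {1}YE lie_wedge// mulmxBr (root_vector_w vv vw sX JX) opprK -/p.
  apply: mulmx_cV_inj => x; rewrite mulmxDl !wedgeE {1 2}XE !wedgeE -scalemxAl.
  rewrite mulmxBl -scalemxAl J2E !wedgeE !bilin_formL vq wq -/d.
  by apply/matrixP => i j; rewrite !mxE; ring.
(* By maximality [X, theta X] lies in a; comparing it with J1 and J2 shows that
   J1 has no component besides the boost wedge p q. *)
have Za : lie X Y \in aa.
  apply: centralizer_aa.
  - apply/mem_pp; split; first by apply/ggP/skew_lie.
    by rewrite tl// tt// lieC.
  - by rewrite lie_jacobi X1 Y1 linearN/= subrr.
  - by rewrite lie_jacobi X2 Y2 linearN/= subrr.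
have w0 : w != 0.
  by apply: contra_eq_neq ww => ->; rewrite bilin_form0l eq_sym oppr_eq0 oner_neq0.
have dJ1 : d *: J1 = wedge p q.
  have Wv : wedge q p *m v = 0.
    by rewrite wedgeE ![bilin_form _ v]bilin_formC vp vq !scale0r subrr.
  have Wp : wedge q p *m p = - d *: p.
    by rewrite wedgeE pp0 (bilin_formC q) scale0r sub0r scaleNr.
  have p0 : p != 0.
    by apply: contraNneq X0 => p0; rewrite XE p0 /wedge trmx0 !mul0mx mulmx0 subrr.
  have [a [b E]] := (mem_aa _).1 Za; rewrite {}ZE wedgeC in E.
  rewrite (wedgeC q) in Wv Wp; move: (wedge p q) E Wv Wp => W E Wv Wp.
  have EM x : 2 *: (- W *m x - d *: (J2 *m x)) = a *: (J1 *m x) + b *: (J2 *m x).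
    by have := congr1 (fun M => M *m x) E; rewrite /= -scalemxAl mulmxBl mulmxDl -!scalemxAl.
  (* Evaluation at v gives b = -2 d, evaluation at p gives a = -2 d; the J2 terms then cancel and
     leave d J1 = wedge p q. *)
  have := EM v; rewrite Wv J1v scaler0 !add0r -/w -scaleNr scalerA => /eqP.
  rewrite -subr_eq0 -scalerBl scaler_eq0 (negPf w0) orbF subr_eq0 => /eqP bE.
  have := EM p; rewrite Wp J2p J1p !scaler0 addr0 subr0 scalerA => /eqP.
  rewrite -subr_eq0 -scalerBl scaler_eq0 (negPf p0) orbF subr_eq0 => /eqP aE.
  apply: mulmx_cV_inj => x; have := EM x; rewrite -aE -bE mulNmx -scalemxAl.
  move: (W *m x) (J1 *m x) (J2 *m x) => A B C /matrixP EE.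
  apply/matrixP => i j; have := EE i j; rewrite !mxE => EE'; lra.
have d0 : d != 0.
  have q0 : q != 0.
    by apply: contraNneq Y0 => q0; rewrite YE q0 /wedge trmx0 !mul0mx mulmx0 subrr.
  have p0 : p != 0.
    by apply: contraNneq X0 => p0; rewrite XE p0 /wedge trmx0 !mul0mx mulmx0 subrr.
  have [x px] := bilin_form_neq0 p0.
  (* If d = 0 then wedge p q = 0, so q is a multiple of p; but J1 p = p while J1 q = -q. *)
  apply: contraNneq q0 => d0; have := congr1 (fun M => M *m x) dJ1.
  rewrite d0 scale0r mul0mx wedgeE => /esym/eqP; rewrite subr_eq0 => /eqP E.
  have qE : q = (bilin_form p x)^-1 *: (bilin_form q x *: p).
    by rewrite E scalerA mulVf// scale1r.
  have := J1q; rewrite {1}qE -!scalemxAr J1p -qE => /eqP.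
  by rewrite -addr_eq0 -mulr2n -scaler_nat scaler_eq0 pnatr_eq0.
exists w, p, (d^-1 *: q); split => //.
- split => //; rewrite !bilin_formL ?qq0 ?mulr0//.
  by rewrite -/d mulVf// vq wq !mulr0.
- apply: (scalerI d0); rewrite dJ1; apply: mulmx_cV_inj => x.
  rewrite -scalemxAl !wedgeE bilin_formL scalerBr !scalerA mulVKf//.
  by rewrite mulrAC mulfV// mul1r.
Qed.

End Cartan.
End AdaptedFrame.

(** * Orbits of AN *)

Section Orbits.
Variables (R : realType) (l : nat).
Implicit Types (X Y : 'M[R]_l.+1) (x y z n : 'cV[R]_l.+1).

(* With y = (x - x') / <x, n>, the exponential of the nilpotent wedge n y is a
   horospherical translation carrying x to x'. *)
Lemma expm_wedge_null n x x' :
  bilin_form n n = 0 -> bilin_form n x' = bilin_form n x ->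
  bilin_form n x != 0 -> bilin_form x' x' = bilin_form x x ->
  expm (wedge n ((bilin_form n x)^-1 *: (x - x'))) *m x = x'.
Proof.
set c := bilin_form n x => nn nx' c0 xx'.
have [y yE] : exists y, y = c^-1 *: (x - x') by eexists.
rewrite -yE; have ny : bilin_form n y = 0 by rewrite yE !bilin_formL nx' -/c subrr mulr0.
have Xn : wedge n y *m n = 0 by rewrite wedgeE nn bilin_formC ny !scale0r subrr.
have Xy : wedge n y *m y = bilin_form y y *: n.
  by rewrite wedgeE ny scale0r subr0.
have Xx : wedge n y *m x = bilin_form y x *: n - c *: y by rewrite wedgeE.
have XXx : wedge n y *m (wedge n y *m x) = - (c * bilin_form y y) *: n.
  by rewrite Xx mulmxBr -!scalemxAr Xn Xy scaler0 sub0r scalerA scaleNr.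
rewrite expm_nilpotent; last by rewrite XXx -scalemxAr Xn scaler0.
rewrite XXx Xx.
(* This is the equality of the square norms of x and x'; it cancels the quadratic term along n. *)
have -> : bilin_form y x = 2^-1 * (c * bilin_form y y).
  rewrite yE !bilin_formL xx' (bilin_formC x' x); field.
  exact: c0.
rewrite [X in _ - _ *: X]yE scalerA mulfV// scale1r scalerA.
by apply/matrixP => i j; rewrite !mxE; ring.
Qed.

(* Only two coordinates carry a positive sign, so some combination of three
   vectors has those two coordinates equal to zero. *)
Lemma exists_nonpos_combination x y z : exists2 r : 'rV[R]_3, r != 0 &
  let t := r 0 0 *: x + r 0 1 *: y + r 0 2%:R *: z in
  bilin_form t t <= 0 /\ (bilin_form t t = 0 -> t = 0).
Proof.
pose C : 'M[R]_(3, l.+1) := \matrix_(i < 3) ([:: x; y; z]`_i)^T.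
pose D : 'M[R]_(3, 2) := \matrix_(i, j) C i (inord j).
have /rowV0Pn[r /sub_kermxP rD r0] : kermx D != 0.
  rewrite -mxrank_eq0 mxrank_ker subn_eq0 -ltnNge.
  by rewrite (leq_ltn_trans (rank_leq_col D)).
exists r => //= ; set t := _ + _ + _.
have tE i : t i 0 = (r *m C) 0 i.
  by rewrite /t !mxE !big_ord_recl big_ord0 !mxE /= addr0 addrA;
    do ! congr (_ + _); congr (r _ _ * _); apply/val_inj.
have t0 (i : 'I_l.+1) : (i < 2)%N -> t i 0 = 0.
  move=> i2; have /matrixP/(_ 0 (Ordinal i2)) := rD.
  rewrite [RHS]mxE tE => <-; rewrite [LHS]mxE [RHS]mxE; apply: eq_bigr => k _.
  by rewrite [D _ _]mxE inord_val.
have tt : bilin_form t t = - \sum_i t i 0 ^+ 2.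
  rewrite bilin_form_sum -sumrN; apply: eq_bigr => i _.
  by case: ifP => [/t0 ->|_]; rewrite ?expr2 ?mulr0 ?oppr0// mulN1r.
rewrite tt oppr_le0 sumr_ge0 => [|i _]; last exact: sqr_ge0.
split=> // /eqP; rewrite oppr_eq0 psumr_eq0 => [/allP t20|i _]; last exact: sqr_ge0.
apply/matrixP => i j; rewrite [j]ord1 [RHS]mxE; apply/eqP.
by rewrite -sqrf_eq0; apply: t20; rewrite mem_index_enum.
Qed.

Variables (v w u u' : 'cV[R]_l.+1).
Hypothesis frame : adapted_frame v w u u'.
Local Notation e := (v + w).
Local Notation J1 := (wedge u u').
Local Notation J2 := (wedge w v).

Let vv : bilin_form v v = 1. Proof. by case: frame. Qed.
Let ww : bilin_form w w = -1. Proof. by case: frame. Qed.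
Let vw : bilin_form v w = 0. Proof. by case: frame. Qed.
Let wv : bilin_form w v = 0. Proof. by rewrite bilin_formC. Qed.
Let uu : bilin_form u u = 0. Proof. by case: frame => _ _ _ []. Qed.
Let u'u' : bilin_form u' u' = 0. Proof. by case: frame => _ _ _ []. Qed.
Let uu' : bilin_form u u' = 1. Proof. by case: frame => _ _ _ _ []. Qed.
Let u'u : bilin_form u' u = 1. Proof. by rewrite bilin_formC. Qed.
Let vu : bilin_form v u = 0. Proof. by case: frame => _ _ _ _ [_ []]. Qed.
Let vu' : bilin_form v u' = 0. Proof. by case: frame => _ _ _ _ [_ []]. Qed.
Let wu : bilin_form w u = 0. Proof. by case: frame => _ _ _ _ [_ []]. Qed.
Let wu' : bilin_form w u' = 0. Proof. by case: frame => _ _ _ _ [_ []]. Qed.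
Let uv : bilin_form u v = 0. Proof. by rewrite bilin_formC. Qed.
Let u'v : bilin_form u' v = 0. Proof. by rewrite bilin_formC. Qed.
Let uw : bilin_form u w = 0. Proof. by rewrite bilin_formC. Qed.
Let u'w : bilin_form u' w = 0. Proof. by rewrite bilin_formC. Qed.
Let gram := (vv, ww, vw, wv, uu, u'u', uu', u'u, vu, vu', wu, wu', (uv, u'v, uw, u'w)).

Let J1u : J1 *m u = u. Proof. by rewrite wedgeE !gram scale1r scale0r subr0. Qed.
Let J1e : J1 *m e = 0.
Proof. by rewrite wedgeE !bilin_formL !gram addr0 !scale0r subrr. Qed.
Let J2u : J2 *m u = 0. Proof. by rewrite wedgeE !gram !scale0r subrr. Qed.
Let J2e : J2 *m e = e.
Proof.
by rewrite wedgeE !bilin_formL !gram addr0 add0r scaleN1r opprK scale1r addrC.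
Qed.

(** Pairing the eigenvalue equation with u gives (c + 1) <u, y> = 0, which removes the u' component
    of J1 y. *)
Lemma J1_eigen y (c : R) : J1 *m y = c *: y -> c + 1 != 0 -> c != 0 ->
  y = (c^-1 * bilin_form u' y) *: u.
Proof.
rewrite wedgeE => E c1 c0; have := congr1 (bilin_form u) E.
rewrite !bilin_formL !gram mulr0 add0r mulr1 => /eqP.
rewrite eq_sym -addr_eq0 -[X in _ + X]mul1r -mulrDl mulf_eq0 (negPf c1)/= => /eqP uy.
by rewrite -scalerA -[X in _ *: X]subr0 -(scale0r u') -uy E scalerA mulVf// scale1r.
Qed.

Lemma J2_eigen y (c : R) : J2 *m y = c *: y -> c ^+ 2 != 1 -> c != 0 -> y = 0.
Proof.
rewrite wedgeE => E c1 c0.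
have Ev := congr1 (bilin_form v) E; have Ew := congr1 (bilin_form w) E.
move: Ev Ew; rewrite !bilin_formL !gram => Ev Ew.
have vy : (c ^+ 2 - 1) * bilin_form v y = 0 by rewrite expr2; nra.
have /eqP : (c ^+ 2 - 1) * bilin_form w y = 0 by rewrite expr2; nra.
move/eqP : vy; rewrite !mulf_eq0 subr_eq0 (negPf c1)/= => /eqP vy /eqP wy.
move: E; rewrite vy wy !scale0r subrr => /esym/eqP.
by rewrite scaler_eq0 (negPf c0) => /eqP.
Qed.

Variables (gg aa : {vspace 'M[R]_l.+1}).
Hypothesis ggP : forall X, X \in gg <-> skew X.
Hypothesis aaP : forall X, X \in aa <-> exists c d : R, X = c *: J1 + d *: J2.
Local Notation nn := (nilpotent_part gg J1 J2).

Let two_neq0 : (1 + 1 : R) != 0. Proof. by rewrite -mulr2n pnatr_eq0. Qed.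

(** X raises J1-weights by 1: X u would have weight 2, which does not occur, and X e has weight 1,
    the line of u. *)
Lemma root_space1_flag X (b : R) : X \in root_space gg J1 J2 1 b ->
  X *m u = 0 /\ exists c, X *m e = c *: u.
Proof.
move=> /root_spaceP[_]; rewrite scale1r => E _; split.
  have : J1 *m (X *m u) = 2 *: (X *m u).
    by rewrite (lie_mulmx _ E) J1u -mulr2n scaler_nat.
  move=> E2; have E3 := J1_eigen E2.
  have X0 : bilin_form u' (X *m u) = 0.
    have := congr1 (bilin_form u') E2; rewrite wedgeE !bilin_formL !gram; lra.
  by rewrite E3 ?X0 ?mulr0 ?scale0r//; rewrite ?pnatr_eq0// natr1 pnatr_eq0.
exists (1^-1 * bilin_form u' (X *m e)); apply: (J1_eigen _ two_neq0 (oner_neq0 _)).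
by rewrite (lie_mulmx _ E) J1e mulmx0 addr0 scale1r.
Qed.

(** X u lies on the line of u, which J2 kills, yet has J2-weight 1; X e would have J2-weight 2. *)
Lemma root_space01_flag X : X \in root_space gg J1 J2 0 1 ->
  X *m u = 0 /\ X *m e = 0.
Proof.
move=> /root_spaceP[_]; rewrite scale0r scale1r => E1 E2; split.
  have E : X *m u = (1^-1 * bilin_form u' (X *m u)) *: u.
    apply: (J1_eigen _ two_neq0 (oner_neq0 _)).
    by rewrite (lie_mulmx _ E1) mul0mx add0r J1u scale1r.
  have := lie_mulmx u E2; rewrite J2u mulmx0 addr0 => <-.
  by rewrite E -scalemxAr J2u scaler0.
apply: (@J2_eigen _ 2); rewrite ?pnatr_eq0//.
  by rewrite (lie_mulmx _ E2) J2e -mulr2n scaler_nat.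
by rewrite -natrX pnatr_eq1.
Qed.

Lemma nn_flag X : X \in nn ->
  [/\ skew X, X *m u = 0 & exists c, X *m e = c *: u].
Proof.
have sk a b Y : Y \in root_space gg J1 J2 a b -> skew Y.
  by move=> /root_spaceP[/ggP].
move=> /memv_addP[_ /memv_addP[_ /memv_addP[X1 h1 [X2 h2 ->]] [X3 h3 ->]] [X4 h4 ->]].
have [[u1 [c1 e1]] [u2 [c2 e2]]] := (root_space1_flag h1, root_space1_flag h2).
have [[u3 [c3 e3]] [u4 e4]] := (root_space1_flag h3, root_space01_flag h4).
split.
- exact: (skewD (skewD (skewD (sk _ _ _ h1) (sk _ _ _ h2)) (sk _ _ _ h3)) (sk _ _ _ h4)).
- by rewrite !mulmxDl u1 u2 u3 u4 !addr0.
- by exists (c1 + c2 + c3); rewrite !mulmxDl e1 e2 e3 e4 addr0 !scalerDl.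
Qed.

Lemma aa_skew X : X \in aa -> skew X.
Proof.
by move=> /aaP[c [d ->]]; apply: skewD; apply: skewZ; exact: skew_wedge.
Qed.

(** Positivity of a and b is what preserves the sign of <u, x> and, where <u, x> = 0, that of <e,
    x>. This is a group containing A and N, so it controls AN without AN being shown to be a
    group. *)
Definition flag_group : set 'M[R]_l.+1 := [set g | SO2 R l g /\
  exists a b c : R, [/\ 0 < a, 0 < b, g *m u = a *: u & g *m e = b *: e + c *: u]].

Lemma flag_subgroup : is_subgroup flag_group.
Proof.
split.
- split; first exact: SO2_1.
  by exists 1, 1, 0; rewrite !mul1mx !scale1r scale0r addr0.
- move=> x y [hx [a [b [c [a0 b0 xu xe]]]]] [hy [a' [b' [c' [a'0 b'0 yu ye]]]]].
  split; first exact: SO2_M.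
  exists (a' * a), (b' * b), (b' * c + c' * a); split; rewrite ?mulr_gt0//.
    by rewrite -mulmxA yu -scalemxAr xu scalerA.
  rewrite -mulmxA ye mulmxDr -!scalemxAr xu xe.
  by apply/matrixP => i j; rewrite !mxE; ring.
- move=> x [hx [a [b [c [a0 b0 xu xe]]]]]; split; first exact: SO2_V.
  have a0' := lt0r_neq0 a0; have b0' := lt0r_neq0 b0.
  have xV y z : x *m y = z -> invmx x *m z = y.
    by move=> <-; rewrite mulmxA mulVmx ?mul1mx// SO2_unit.
  exists a^-1, b^-1, (- (b^-1 * c * a^-1)); split; rewrite ?invr_gt0//.
    by apply: xV; rewrite -scalemxAr xu scalerA mulVf// scale1r.
  apply: xV; rewrite mulmxDr -!scalemxAr xe xu; apply/matrixP => i j; rewrite !mxE.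
  by field; rewrite a0' b0'.
Qed.

Lemma connected_aa_flag : connected_subgroup aa `<=` flag_group.
Proof.
apply: (connected_subgroup_sub flag_subgroup) => X Xa; split.
  by rewrite -[X]scale1r; apply: SO2_expm; exact: aa_skew.
have [c [d XE]] := (aaP X).1 Xa.
exists (expR c), (expR d), 0; split; rewrite ?expR_gt0//.
  by apply: expm_eigen; rewrite XE mulmxDl -!scalemxAl J1u J2u scaler0 addr0.
rewrite scale0r addr0; apply: expm_eigen.
by rewrite XE mulmxDl -!scalemxAl J1e J2e scaler0 add0r.
Qed.

Lemma connected_nn_flag : connected_subgroup nn `<=` flag_group.
Proof.
apply: (connected_subgroup_sub flag_subgroup) => X /nn_flag[sX Xu [c Xe]]; split.
  by rewrite -[X]scale1r; exact: SO2_expm.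
exists 1, 1, c; split => //; first by rewrite expm_kernel// scale1r.
have XXe : X *m (X *m e) = 0 by rewrite Xe -scalemxAr Xu scaler0.
by rewrite expm_nilpotent XXe ?mulmx0// scaler0 addr0 Xe scale1r.
Qed.

Local Notation AN := (product_set (connected_subgroup aa) (connected_subgroup nn)).

Lemma AN_flag : AN `<=` flag_group.
Proof.
move=> _ [a [n [/connected_aa_flag ha /connected_nn_flag hn ->]]].
by have [_ + _] := flag_subgroup; apply.
Qed.

Lemma flag_group_u r x : flag_group r -> exists2 a, 0 < a &
  bilin_form u x = a * bilin_form u (r *m x).
Proof.
move=> [/SO2_orthogonal or [a [b [c [a0 _ ru _]]]]]; exists a => //.
by rewrite -or ru bilin_formL.
Qed.

Lemma flag_group_e r x : flag_group r -> bilin_form u x = 0 -> exists2 b, 0 < b &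
  bilin_form e x = b * bilin_form e (r *m x).
Proof.
move=> fr ux; have [a a0 Ea] := flag_group_u x fr.
move: fr => [/SO2_orthogonal or [_ [b [c [_ b0 _ re]]]]]; exists b => //.
have -> : bilin_form e x = bilin_form (b *: e + c *: u) (r *m x) by rewrite -re or.
rewrite [LHS]bilin_formDl [in LHS]bilin_formZl [X in _ + X]bilin_formZl.
suff -> : bilin_form u (r *m x) = 0 by rewrite mulr0 addr0.
by move: Ea; rewrite ux => /esym/eqP; rewrite mulf_eq0 (gt_eqF a0) => /eqP.
Qed.

(** For y orthogonal to u this is the component orthogonal to u, u', v and w, on which J1 and J2
    vanish; the sign of the last term comes from <w, w> = -1. *)
Let transverse y := y - bilin_form u' y *: u - bilin_form v y *: v + bilin_form w y *: w.

Let transverse_J y : bilin_form u y = 0 ->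
  J1 *m transverse y = 0 /\ J2 *m transverse y = 0.
Proof.
move=> uy; rewrite !wedgeE /transverse !bilin_formL !gram uy.
by split; apply/matrixP => i j; rewrite !mxE; ring.
Qed.

Let mem_nn a b X : X \in root_space gg J1 J2 a b ->
  (a, b) \in [:: (1, 1); (1, -1); (1, 0); (0, 1)] -> X \in nn.
Proof.
move=> Xr; rewrite !inE => /or4P[] /eqP[aE bE]; rewrite {}aE {}bE in Xr.
- by do 3! apply: (subvP (addvSl _ _)).
- by do 2! apply: (subvP (addvSl _ _)); apply: (subvP (addvSr _ _)).
- by apply: (subvP (addvSl _ _)); apply: (subvP (addvSr _ _)).
- by apply: (subvP (addvSr _ _)).
Qed.

Let mem_root_wedge (c d a b : R) x y : J1 *m x = c *: x -> J2 *m x = d *: x ->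
  J1 *m y = a *: y -> J2 *m y = b *: y ->
  wedge x y \in root_space gg J1 J2 (c + a) (d + b).
Proof.
move=> x1 x2 y1 y2; apply/root_spaceP; split; first exact/ggP/skew_wedge.
  rewrite lie_wedge ?x1 ?y1; last exact: skew_wedge.
  by apply: mulmx_cV_inj => z; rewrite mulmxDl -scalemxAl !wedgeE !bilin_formL;
    apply/matrixP => i j; rewrite !mxE; ring.
rewrite lie_wedge ?x2 ?y2; last exact: skew_wedge.
by apply: mulmx_cV_inj => z; rewrite mulmxDl -scalemxAl !wedgeE !bilin_formL;
  apply/matrixP => i j; rewrite !mxE; ring.
Qed.

(** u has weight (1, 0). Being orthogonal to u, y has no u' component, so it is a sum of vectors of
    weights (0, 0), (0, 1), (0, -1) and a multiple of u; weights add in a wedge, and wedge u u =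
    0. *)
Lemma wedge_u_nn y : bilin_form u y = 0 -> wedge u y \in nn.
Proof.
move=> uy; have [z1 z2] := transverse_J uy.
have J2e' : J2 *m (v - w) = -1 *: (v - w).
  rewrite wedgeE !bilin_formL !gram; apply/matrixP => i j; rewrite !mxE; ring.
have J1e' : J1 *m (v - w) = 0 *: (v - w).
  rewrite wedgeE !bilin_formL !gram; apply/matrixP => i j; rewrite !mxE; ring.
have yE : y = transverse y + bilin_form u' y *: u +
    (2^-1 * (bilin_form v y - bilin_form w y)) *: e +
    (2^-1 * (bilin_form v y + bilin_form w y)) *: (v - w).
  by rewrite /transverse; apply/matrixP => i j; rewrite !mxE; field.
move: (transverse y) yE z1 z2 => t yE z1 z2.
rewrite [X in wedge _ X]yE 3!wedgeDr 3!wedgeZr wedgexx scaler0 addr0.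
have J1u1 : J1 *m u = 1 *: u by rewrite J1u scale1r.
have J2u0 : J2 *m u = 0 *: u by rewrite J2u scale0r.
apply: memvD; first apply: memvD.
- apply: (@mem_nn 1 0); last by rewrite !inE !eqxx !orbT.
  have := @mem_root_wedge 1 0 0 0 u t; rewrite !addr0 !scale0r; exact.
- apply: memvZ; apply: (@mem_nn 1 1); last by rewrite !inE !eqxx.
  have := @mem_root_wedge 1 0 0 1 u e; rewrite addr0 add0r; apply => //.
    by rewrite scale0r.
  by rewrite scale1r.
- apply: memvZ; apply: (@mem_nn 1 (-1)); last by rewrite !inE !eqxx !orbT.
  by have := @mem_root_wedge 1 0 0 (-1) u (v - w); rewrite addr0 add0r; apply.
Qed.

(** e has weight (0, 1). Orthogonality to e removes the v - w component of y, whose wedge with e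
    would be a multiple of J2. *)
Lemma wedge_e_nn y : bilin_form u y = 0 -> bilin_form e y = 0 -> wedge e y \in nn.
Proof.
move=> uy ey; have [z1 z2] := transverse_J uy.
have wy : bilin_form w y = - bilin_form v y by move: ey; rewrite bilin_formL; lra.
have yE : y = transverse y + - bilin_form u' y *: (- u) + bilin_form v y *: e.
  by rewrite /transverse wy; apply/matrixP => i j; rewrite !mxE; ring.
move: (transverse y) yE z1 z2 => t yE z1 z2.
rewrite [X in wedge _ X]yE 2!wedgeDr 2!wedgeZr wedgexx scaler0 addr0.
apply: memvD.
- apply: (@mem_nn 0 1); last by rewrite !inE !eqxx !orbT.
  have := @mem_root_wedge 0 1 0 0 e t; rewrite !addr0 !scale0r; apply => //.
  by rewrite scale1r.
- apply: memvZ; rewrite -[- u]scaleN1r wedgeZr wedgeC scalerN scaleN1r opprK.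
  by apply: wedge_u_nn; rewrite bilin_formL !gram addr0.
Qed.


Lemma expm_scale X n (k : R) : X *m n = n -> 0 < k -> expm (ln k *: X) *m n = k *: n.
Proof.
by move=> Xn k0; rewrite (@expm_eigen _ _ _ _ (ln k)) ?lnK// -scalemxAl Xn.
Qed.

(** Common to both kinds of orbits, with (X, n) = (J1, u) or (J2, e): an element of A adjusts the
    product with n, then a horospherical translation in N does the rest. *)
Lemma AN_transport X n x x' : X \in aa -> X *m n = n -> bilin_form n n = 0 ->
  0 < bilin_form n x * bilin_form n x' -> bilin_form x' x' = bilin_form x x ->
  (forall (a : 'M[R]_l.+1) (k : R), connected_subgroup aa a ->
    bilin_form n (x - invmx a *m x') = 0 ->
    wedge n (k *: (x - invmx a *m x')) \in nn) ->
  exists2 r, AN r & r *m x = x'.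
Proof.
move=> Xa Xn nn0 xx' E wnn; have nx0 : bilin_form n x != 0.
  by apply: contraTneq xx' => ->; rewrite mul0r ltxx.
have nx'0 : bilin_form n x' != 0.
  by apply: contraTneq xx' => ->; rewrite mulr0 ltxx.
(* If a scales n by k, then <n, a^-1 x'> = k <n, x'> = <n, x>; the sign hypothesis makes k positive,
   hence an exponential. *)
pose k := bilin_form n x / bilin_form n x'.
have k0 : 0 < k.
  have -> : k = bilin_form n x * bilin_form n x' / bilin_form n x' ^+ 2.
    by rewrite /k; field.
  by rewrite divr_gt0// exprn_even_gt0.
have an := expm_scale Xn k0.
have Aa : connected_subgroup aa (expm (ln k *: X)).
  by apply: connected_subgroup_expm; rewrite memvZ.
move: (expm (ln k *: X)) an Aa => a an Aa.
have oa : orthogonal_mx a by have [/SO2_orthogonal] := connected_aa_flag Aa.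
have aK y : a *m (invmx a *m y) = y.
  by rewrite mulmxA mulmxV ?mul1mx// orthogonal_mx_unit.
have := wnn a (bilin_form n x)^-1 Aa.
have : a *m (invmx a *m x') = x' by [].
move: (invmx a *m x') => x'' ax'' wn.
have nx'' : bilin_form n x'' = bilin_form n x.
  by rewrite -[LHS]oa an ax'' bilin_formL /k divfK.
have x''x'' : bilin_form x'' x'' = bilin_form x x by rewrite -E -ax'' oa.
exists (a *m expm (wedge n ((bilin_form n x)^-1 *: (x - x'')))).
  exists a, (expm (wedge n ((bilin_form n x)^-1 *: (x - x'')))); split => //.
  apply: connected_subgroup_expm; apply: wn.
  by rewrite !bilin_formL nx'' subrr.
by rewrite -mulmxA (expm_wedge_null nn0 nx'' nx0 x''x'').
Qed.

Lemma AN_open_orbit x x' : 0 < bilin_form u x * bilin_form u x' ->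
  bilin_form x' x' = bilin_form x x -> exists2 r, AN r & r *m x = x'.
Proof.
move=> ux E; apply: (@AN_transport J1 u) => //.
  by apply/aaP; exists 1, 0; rewrite scale1r scale0r addr0.
by move=> a k _ h; apply: wedge_u_nn; rewrite bilin_formZr h mulr0.
Qed.

Lemma AN_closed_orbit x x' : bilin_form u x = 0 -> bilin_form u x' = 0 ->
  0 < bilin_form e x * bilin_form e x' -> bilin_form x' x' = bilin_form x x ->
  exists2 r, AN r & r *m x = x'.
Proof.
move=> ux ux' ex E; apply: (@AN_transport J2 e) => //.
- by apply/aaP; exists 0, 1; rewrite scale1r scale0r add0r.
- by rewrite !bilin_formL !gram; ring.
move=> a k Aa h; apply: wedge_e_nn; last by rewrite [LHS]bilin_formZr h mulr0.
have [b b0 Eb] := flag_group_u (invmx a *m x') (connected_aa_flag Aa).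
have au : a \in unitmx.
  by have [/SO2_unit] := connected_aa_flag Aa.
by rewrite !bilin_formL ux Eb mulmxA mulmxV// mul1mx ux'; ring.
Qed.

(** Otherwise x, u, e would be mutually orthogonal of square norms 1, 0, 0 and span a positive
    semidefinite space of dimension 3, against the two positive signs of the form. *)
Lemma null_transverse_neq0 x :
  bilin_form x x = 1 -> bilin_form u x = 0 -> bilin_form e x != 0.
Proof.
move=> xx ux; apply/eqP => ex.
have [r r0 [ypos]] := exists_nonpos_combination x u e.
set t := _ + _ + _ => t0.
have xt : bilin_form x t = r 0 0.
  by rewrite /t [LHS]bilin_formC !bilin_formL xx ux; move: ex; rewrite bilin_formL; nra.
have ut : bilin_form u t = 0 by rewrite /t !bilin_formL !gram ux; ring.
have et : bilin_form e t = 0.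
  by rewrite /t !bilin_formL !gram; move: ex; rewrite bilin_formL; nra.
have tt : bilin_form t t = r 0 0 ^+ 2.
  rewrite {1}/t !bilin_formDl !bilin_formZl xt ut; move: et; rewrite bilin_formL; nra.
have x0 : r 0 0 = 0.
  by apply/eqP; rewrite -sqrf_eq0 eq_le -tt ypos tt sqr_ge0.
have {}t0 : t = 0 by apply: t0; rewrite tt x0 expr0n.
have u0 : r 0 1 = 0.
  by have := congr1 (bilin_form u') t0; rewrite /t x0 !bilin_formL !gram; lra.
have e0 : r 0 2%:R = 0.
  by have := congr1 (bilin_form v) t0; rewrite /t x0 u0 !bilin_formL !gram; lra.
move/eqP: r0; apply; apply/rowP => i; rewrite mxE.
have /or3P[] : [|| i == 0, i == 1 | i == 2%:R] by case: i => [[|[|[]]]].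
- by move/eqP->.
- by move/eqP->.
- by move/eqP->.
Qed.

Lemma AN_SO2 r : AN r -> SO2 R l r.
Proof. by move=> /AN_flag[]. Qed.

Lemma AN_orbitP g h : SO2 R l g -> SO2 R l h ->
  AdS_orbit AN (AdS_proj v g) (AdS_proj v h) <->
  exists2 r, AN r & r *m (g *m v) = h *m v.
Proof.
move=> hg hh; split=> [[r hr]|[r hr E]].
  rewrite AdS_act_proj => /AdS_projP E; exists r => //; rewrite mulmxA E//.
  by apply: SO2_M => //; exact: AN_SO2.
exists r => //; rewrite AdS_act_proj; apply/AdS_projP => //.
  by apply: SO2_M => //; exact: AN_SO2.
by rewrite -mulmxA.
Qed.

Lemma continuous_bilin_orbit x :
  continuous (fun h : 'M[R]_l.+1 => bilin_form x (h *m v)).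
Proof.
move=> h; rewrite /bilin_form.
have : (fun k : 'M[R]_l.+1 => x^T *m form_mx R l *m (k *m v)) @ h -->
    x^T *m form_mx R l *m (h *m v).
  apply: (cvg_mulmx (nbhs_filter h) (cvg_cst _)).
  exact: (cvg_mulmx (nbhs_filter h) cvg_id (cvg_cst _)).
by move=> /cvg_mxP; exact.
Qed.

Let pos_norm g : SO2 R l g -> bilin_form (g *m v) (g *m v) = 1.
Proof. by move=> /SO2_orthogonal ->. Qed.

Lemma closed_AN_orbit g : SO2 R l g -> bilin_form u (g *m v) = 0 ->
  closed_AdS v (AdS_orbit AN (AdS_proj v g)).
Proof.
move=> hg ug; apply/closed_subspaceP.
pose s := bilin_form e (g *m v).
have s0 : s != 0 by apply: null_transverse_neq0 => //; exact: pos_norm.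
(* The weak inequality makes the set closed; equality never occurs on it, by
   [null_transverse_neq0]. *)
exists ((fun h : 'M[R]_l.+1 => bilin_form u (h *m v)) @^-1` [set 0] `&`
        (fun h : 'M[R]_l.+1 => s * bilin_form e (h *m v)) @^-1` [set t | 0 <= t]).
  apply: closedI.
    apply: preimage_closed; last exact: closed_eq.
    by move=> h _; exact: continuous_bilin_orbit.
  apply: preimage_closed; last exact: closed_ge.
  move=> h _; apply: cvgMl_tmp; first exact: nbhs_filter h.
  exact: continuous_bilin_orbit.
apply/seteqP; split=> h [].
  move=> [/= uh sh] hh; split => //; apply/AN_orbitP => //.
  apply: AN_closed_orbit => //; last by rewrite !pos_norm.
  rewrite lt_neqAle sh andbT eq_sym mulf_neq0//.
  by apply: null_transverse_neq0 => //; exact: pos_norm.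
move=> + hh => /AN_orbitP[]// r hr E; split => //.
have [a a0 Ea] := flag_group_u (g *m v) (AN_flag hr).
have [b b0 Eb] := flag_group_e (AN_flag hr) ug.
split=> /=.
  by move: Ea; rewrite E ug => /esym/eqP; rewrite mulf_eq0 (gt_eqF a0) => /eqP.
by rewrite /s Eb E -mulrA mulr_ge0 ?(ltW b0)// -expr2 sqr_ge0.
Qed.

Lemma AN_orbit_not_closed g : SO2 R l g -> bilin_form u (g *m v) != 0 ->
  ~ closed_AdS v (AdS_orbit AN (AdS_proj v g)).
Proof.
set s := bilin_form u _ => hg s0 /closed_subspaceP[V cV VE].
(* The points v + t u' lie in the orbit whenever t has the sign of s, but their
   limit v does not. *)
pose X := wedge u' v.
have sX : skew X by exact: skew_wedge.
have expX t : expm (t *: X) *m v = v + t *: u'.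
  have Xv : X *m v = u' by rewrite wedgeE !gram scale1r scale0r subr0.
  have Xu' : X *m u' = 0 by rewrite wedgeE !gram !scale0r subrr.
  have tXv : t *: X *m v = t *: u' by rewrite -scalemxAl Xv.
  have tXXv : t *: X *m (t *: X *m v) = 0.
    by rewrite tXv -scalemxAl -scalemxAr Xu' !scaler0.
  by rewrite expm_nilpotent tXXv ?mulmx0// tXv scaler0 addr0.
have VX k : V (expm ((s * harmonic k) *: X)).
  have hk : SO2 R l (expm ((s * harmonic k) *: X)) by exact: SO2_expm.
  suff [] : (V `&` SO2 R l) (expm ((s * harmonic k) *: X)) by [].
  rewrite VE; split => //; apply/AN_orbitP => //; apply: AN_open_orbit.
    rewrite expX !bilin_formL !gram add0r mulr1 -/s mulrA -expr2 mulr_gt0//.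
      by rewrite exprn_even_gt0.
    exact: harmonic_gt0.
  by rewrite !pos_norm.
have sk : (fun k => s * harmonic k : R) @ \oo --> (0 : R).
  by rewrite -[X in _ --> X](mulr0 s); apply: cvgMl_tmp; exact: cvg_harmonic.
have : V (expm (0 *: X)).
  apply: (@closed_cvg _ _ _ eventually_filter (fun k => expm ((s * harmonic k) *: X)) V cV).
    by near=> k; exact: VX.
  exact: (cvg_comp _ _ sk (@continuous_expm R l X 0)).
rewrite scale0r expm0 => V1.
have : (V `&` SO2 R l) 1%:M by split => //; exact: SO2_1.
rewrite VE => -[/AN_orbitP[//||r hr]]; first exact: SO2_1.
rewrite mul1mx => E _; have [a a0] := flag_group_u (g *m v) (AN_flag hr).
by rewrite E uv mulr0 => /eqP; rewrite (negPf s0).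
Unshelve. all: by end_near. Qed.

Lemma AN_id : AN 1%:M.
Proof.
exists 1%:M, 1%:M; rewrite mulmx1.
have K1 (U : {vspace 'M[R]_l.+1}) : connected_subgroup U 1%:M.
  by have [] := connected_subgroup_subgroup U.
by split.
Qed.

Lemma closed_AN_orbitsP g : SO2 R l g ->
  (exists2 O, closed_orbits v AN O & O (AdS_proj v g)) <->
  bilin_form u (g *m v) = 0.
Proof.
move=> hg; split=> [OP|ug].
  have [orb [cO [p [g0 hg0 pE] orbE]] Og] := OP.
  rewrite {}orbE -pE in cO Og; have [//|//|r hr E] := (AN_orbitP _ _).1 Og.
  have [//|/eqP s0] := pselect (bilin_form u (g *m v) = 0).
  have [a a0 Ea] := flag_group_u (g0 *m v) (AN_flag hr).
  exfalso; apply: (AN_orbit_not_closed hg0) cO.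
  by rewrite Ea E mulf_neq0// gt_eqF.
exists (AdS_orbit AN (AdS_proj v g)).
  by split; [exact: closed_AN_orbit|exists (AdS_proj v g) => //; exists g].
by apply/AN_orbitP => //; exists 1%:M; [exact: AN_id|rewrite mul1mx].
Qed.

End Orbits.

(** * The metric on AdS *)

Section Metric.
Variables (R : realType) (l : nat) (v : 'cV[R]_l.+1).
Implicit Types (X Y g h : 'M[R]_l.+1).

(** Coordinates of the embedding [g] |-> g v, read on a chosen representative; all representatives
    agree because H fixes v. As smooth test functions they recover g X v from a velocity. *)
Definition orbit_coord (i : 'I_l.+1) (p : set 'M[R]_l.+1) : R :=
  (xget 0 p *m v) i 0.

Lemma orbit_coordE i g : orbit_coord i (AdS_proj v g) = (g *m v) i 0.
Proof.
have : (AdS_proj v g) (xget 0 (AdS_proj v g)).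
  apply: (@xgetPex _ 0 (AdS_proj v g)); exists g, 1%:M; last by rewrite mulmx1.
  by split; [exact: SO2_1|rewrite mul1mx].
by rewrite /orbit_coord => -[k [_ kv] <-]; rewrite -mulmxA kv.
Qed.

Definition mulmx_coord (i : 'I_l.+1) g : R := (g *m v) i 0.

Fact mulmx_coord_is_linear i : linear (mulmx_coord i).
Proof. by move=> a g h; rewrite /mulmx_coord mulmxDl -scalemxAl !mxE. Qed.

HB.instance Definition _ i := GRing.isLinear.Build R 'M[R]_l.+1 R *:%R
  (mulmx_coord i) (mulmx_coord_is_linear i).

Lemma continuous_mulmx_coord i : continuous (mulmx_coord i).
Proof.
move=> g; have : (fun k : 'M[R]_l.+1 => k *m v) @ g --> g *m v.
  exact: (cvg_mulmx (nbhs_filter g) cvg_id (cvg_cst _)).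
by move=> /cvg_mxP; exact.
Qed.

Lemma smooth_mulmx_coord i : smooth (mulmx_coord i).
Proof.
have dF x : differentiable (mulmx_coord i) x.
  exact/linear_differentiable/continuous_mulmx_coord.
have DF u : 'D_u (mulmx_coord i) = cst (mulmx_coord i u).
  apply/funext => x; rewrite deriveE//.
  by rewrite diff_lin//; exact: continuous_mulmx_coord.
move=> s x; case: s => [|u s]; first exact: dF.
suff [c ->] : exists c : R, foldr (fun u (E : 'M[R]_l.+1 -> R) => 'D_u E)
    (mulmx_coord i) (u :: s) = cst c by exact: differentiable_cst.
elim: s u => [|u' s IH] u /=; first by exists (mulmx_coord i u); exact: DF.
have [c /= Ec] := IH u'; exists 0; rewrite Ec; apply/funext => y.
by rewrite derive_cst.
Qed.

Lemma smooth_orbit_coord i : smooth_AdS v (orbit_coord i).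
Proof.
move=> g hg; exists (mulmx_coord i); first exact: smooth_mulmx_coord.
by near=> h => _; rewrite orbit_coordE.
Unshelve. all: by end_near. Qed.

Lemma continuous_mul_expm g X : continuous (fun t : R => g *m expm (t *: X)).
Proof.
move=> t; apply: (cvg_mulmx (nbhs_filter t) (cvg_cst _)).
exact: continuous_expm.
Qed.

(** By the chain rule through a local extension F, the velocity becomes linear in X. *)
Lemma velocity_expm g X (f : {f : set 'M[R]_l.+1 -> R | smooth_AdS v f})
    (F : 'M[R]_l.+1 -> R) : SO2 R l g -> skew X -> smooth F ->
  (\forall h \near g, SO2 R l h -> sval f (AdS_proj v h) = F h) ->
  velocity v (fun t => AdS_proj v (g *m expm (t *: X))) f = 'd F g (g *m X).
Proof.
move=> hg sX sF fF; rewrite /velocity derive1E.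
pose c (t : R) := g *m expm (t *: X).
have c0 : c 0 = g by rewrite /c scale0r expm0 mulmx1.
have SOc t : SO2 R l (c t) by apply: SO2_M => //; exact: SO2_expm.
rewrite (@near_eq_derive _ _ _ _ (F \o c)); last first.
  have := @continuous_mul_expm g X 0; rewrite /continuous_at -/(c 0) c0.
  move=> /(_ _ fF); rewrite /= => H; near=> t.
  have : SO2 R l (g *m expm (t *: X)) -> sval f (AdS_proj v (g *m expm (t *: X))) =
     F (g *m expm (t *: X)) by near: t.
  by apply; exact: SOc.
have dc i j : is_derive (0 : R) 1 (fun t => c t i j) ((g *m X) i j).
  have := is_derive_expm g X 1%:M i j 0; rewrite scale0r expm0 !mulmx1.
  by under [X in is_derive _ _ X _ -> _]eq_fun do rewrite mulmx1.
have derc : derivable c 0 1 by apply/derivable_mxP => i j; have [] := dc i j.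
have diffc : differentiable c 0 by apply/derivable1_diffP.
have diffF : differentiable F (c 0) by exact: (sF [::]).
rewrite deriveE; last exact: differentiable_comp.
rewrite diff_comp//= -(deriveE _ diffc) derive_mx// c0; congr ('d F g _).
by apply/matrixP => i j; rewrite mxE; have [_ ->] := dc i j.
Unshelve. all: by end_near. Qed.

(** By linearity it suffices to treat X - Y, which kills v: its curve is constant in AdS. This
    permits replacing an element of g by its q-component. *)
Lemma velocity_isotropy g X Y : SO2 R l g -> skew X -> skew Y ->
  X *m v = Y *m v ->
  velocity v (fun t => AdS_proj v (g *m expm (t *: X))) =
  velocity v (fun t => AdS_proj v (g *m expm (t *: Y))).
Proof.
move=> hg sX sY XY; apply/funext => f; have [F sF fF] := svalP f _ hg.
rewrite (velocity_expm hg sX sF fF) (velocity_expm hg sY sF fF).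
have sZ : skew (X - Y) by rewrite -scaleN1r; apply: skewD => //; exact: skewZ.
apply/eqP; rewrite -subr_eq0 -linearB/= -mulmxBr; apply/eqP.
rewrite -(velocity_expm hg sZ sF fF) /velocity.
rewrite (_ : (fun t => _) = cst (sval f (AdS_proj v g))) ?derive1_cst//.
apply/funext => t /=; congr (sval f _); apply/AdS_projP => //.
  by apply: SO2_M => //; exact: SO2_expm.
rewrite -mulmxA expm_kernel// -scalemxAl mulmxBl XY subrr scaler0.
by [].
Qed.

Lemma velocity_orbit_coord g X i (f := exist _ _ (smooth_orbit_coord i)) :
  velocity v (fun t => AdS_proj v (g *m expm (t *: X))) f = (g *m X *m v) i 0.
Proof.
rewrite /velocity derive1E /=; under eq_fun do rewrite orbit_coordE.
have [_ ->] := is_derive_expm g X v i 0 0.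
by rewrite scale0r expm0 mulmx1.
Qed.

Variables (gg qq : {vspace 'M[R]_l.+1}).
Hypothesis sqnormE : forall X, X \in qq ->
  sqnorm gg X = bilin_form (X *m v) (X *m v).

(** The choice in [metric_sqnorm] is harmless: a second representation (g', X') of the same vector
    has g' X' v = g X v, and g, g' are isometries. *)
Lemma metric_sqnorm_velocity g X : SO2 R l g -> X \in qq ->
  metric_sqnorm gg qq (AdS_proj v g)
    (velocity v (fun t => AdS_proj v (g *m expm (t *: X)))) =
  bilin_form (X *m v) (X *m v).
Proof.
move=> hg Xq; apply: xget_unique; first by exists g, X; rewrite sqnormE.
move=> r [g' [X' [hg' _ X'q E ->]]]; rewrite (sqnormE X'q).
have gX : g *m X *m v = g' *m X' *m v.
  apply/matrixP => i j; rewrite [j]ord1.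
  have E1 := velocity_orbit_coord g X i; have E2 := velocity_orbit_coord g' X' i.
  exact: etrans (esym E1) (etrans (congr1 (fun t : tangent v => t _) E) E2).
have := SO2_orthogonal hg' (X' *m v) (X' *m v).
by rewrite mulmxA -gX -mulmxA => <-; exact: SO2_orthogonal hg _ _.
Qed.

(** Conjugation moves g to the left: exp (- t X) g = g exp (- t Ad (g^-1) X). *)
Lemma fundamental_fieldE X g : SO2 R l g ->
  fundamental_field v X g =
  velocity v (fun t => AdS_proj v (g *m expm (t *: - Ad (invmx g) X))).
Proof.
move=> hg; congr velocity; apply/funext => t; congr AdS_proj.
have gu := SO2_unit hg.
have -> : expm (- t *: X) = g *m expm (t *: - Ad (invmx g) X) *m invmx g.
  rewrite -expm_conj//; congr expm.
  rewrite /Ad invmxK -scalemxAr -scalemxAl mulmxN mulNmx !mulmxA mulmxV// mul1mx.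
  by rewrite mulmxK// scalerN scaleNr.
by rewrite -mulmxA mulVmx// mulmx1.
Qed.

End Metric.

(** * The norm of the fundamental field and the singularity *)

Lemma sqnorm_wedge_null (R : realType) (l : nat) (v w u u' x : 'cV[R]_l.+1) :
  adapted_frame v w u u' ->
  bilin_form (wedge u u' *m x) (wedge u u' *m x) =
  - 2 * (bilin_form u x * bilin_form u' x).
Proof.
move=> [_ _ _ [uu u'u'] [uu' _]].
by rewrite wedgeE !bilin_formL (bilin_formC u' u) uu u'u' uu'; ring.
Qed.

(** Since theta negates J1 and J2, this presents [nnbar] as the nilpotent part for (-J1, -J2), so
    that the results on AN cover A Nbar. *)
Lemma limg_root_space (R : realType) (l : nat) (gg pp aa : {vspace 'M[R]_l.+1})
    (theta : 'End('M[R]_l.+1)) (J1 J2 : 'M[R]_l.+1) (a b : R) :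
  is_cartan_involution gg theta ->
  pp = (gg :&: passmx.leigenspace theta (-1))%VS ->
  is_maximal_abelian aa pp -> basis_of aa [:: J1; J2] ->
  (theta @: root_space gg J1 J2 a b)%VS = root_space gg (- J1) (- J2) a b.
Proof.
move=> thetaP ppE aaP basisJ; have [[tg tt tl] _] := thetaP.
have root_opp c d X : X \in root_space gg (- J1) (- J2) c d <->
    X \in root_space gg J1 J2 (- c) (- d).
  split=> /root_spaceP[Xg E1 E2]; apply/root_spaceP; split=> //.
  - by rewrite -[J1]opprK lieNl E1 scaleNr.
  - by rewrite -[J2]opprK lieNl E2 scaleNr.
  - by rewrite lieNl E1 scaleNr opprK.
  - by rewrite lieNl E2 scaleNr opprK.
apply/vspaceP => X; apply/idP/idP.
  move=> /memv_imgP[Y /(theta_root_space thetaP ppE aaP basisJ) Yr ->].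
  exact/root_opp.
move=> /root_opp Xr; have [Xg _ _] := (root_spaceP _ _ _ _ _ _).1 Xr.
rewrite -(tt X Xg); apply: memv_img.
by rewrite -[a]opprK -[b]opprK; exact: (theta_root_space thetaP ppE aaP basisJ).
Qed.

Theorem theorem68 (R : realType) (l : nat) (hl : (3 <= l)%N)
    (v : 'cV[R]_l.+1) (hv : bilin_form v v = 1)
    (gg hh : {vspace 'M[R]_l.+1})
    (hgg : is_lie_algebra_of (SO2 R l) gg)
    (hhh : is_lie_algebra_of (isotropy v) hh)
    (sigma : 'End('M[R]_l.+1))
    (hsigma : is_involutive_automorphism gg sigma)
    (hsigma_fix : (gg :&: passmx.leigenspace sigma 1)%VS = hh)
    (qq : {vspace 'M[R]_l.+1})
    (hqq : qq = (gg :&: passmx.leigenspace sigma (-1))%VS)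
    (theta : 'End('M[R]_l.+1))
    (htheta : is_cartan_involution gg theta)
    (hcomm : forall X, X \in gg -> sigma (theta X) = theta (sigma X))
    (pp : {vspace 'M[R]_l.+1})
    (hpp : pp = (gg :&: passmx.leigenspace theta (-1))%VS)
    (aa : {vspace 'M[R]_l.+1})
    (haa : is_maximal_abelian aa pp)
    (J1 J2 : 'M[R]_l.+1)
    (hJ : basis_of aa [:: J1; J2])
    (hJ1 : J1 \in hh) (hJ2 : J2 \in qq)
    (hroots : forall r : R * R,
       is_restricted_root gg J1 J2 r <-> r \in root_list R l)
    (nn nnbar : {vspace 'M[R]_l.+1})
    (hnn : nn = nilpotent_part gg J1 J2)
    (hnnbar : nnbar = (theta @: nn)%VS)
    (A N Nbar : set 'M[R]_l.+1)
    (hA : A = connected_subgroup aa)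
    (hN : N = connected_subgroup nn)
    (hNbar : Nbar = connected_subgroup nnbar)
    (g : 'M[R]_l.+1) (hg : SO2 R l g) :
  metric_sqnorm gg qq (AdS_proj v g) (fundamental_field v J1 g)
    = sqnorm gg (daddv_pi qq hh (Ad (invmx g) J1))
  /\ (singularity v A N Nbar (AdS_proj v g) <->
      metric_sqnorm gg qq (AdS_proj v g) (fundamental_field v J1 g) = 0).
Proof.
have ggP X : X \in gg <-> skew X.
  exact: iff_trans (hgg X) (iff_sym (SO2_lie_algebraP X)).
have hhP X : X \in hh <-> skew X /\ X *m v = 0.
  exact: iff_trans (hhh X) (iff_sym (isotropy_lie_algebraP v X)).
have l1 : (1 < l)%N by exact: ltnW.
have J2E := qq_wedge l1 ggP hhP hsigma hsigma_fix hqq hv hJ2.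
have [sJ1 J1v] := (hhP J1).1 hJ1.
have root11 : root_space gg J1 J2 1 1 <> 0%VS.
  by have [] := (hroots (1, 1)).2 (mem_head _ _).
have [w [u [u' [frame J1E J2wE]]]] :=
  adapted_frame_exists ggP htheta hpp haa hJ hv J1v J2E root11.
have aaP X : X \in aa <-> exists c d : R, X = c *: wedge u u' + d *: wedge w v.
  by rewrite -J1E -J2wE; exact: mem_aa hJ X.
have J1g : J1 \in gg by exact/ggP.
have og := SO2_orthogonal hg; have gu := SO2_unit hg.
have Yg : Ad (invmx g) J1 \in gg.
  apply/ggP => x y; rewrite /Ad invmxK -!mulmxA -[in RHS]orthogonal_mxV//.
  have oV : orthogonal_mx (invmx g) by exact/SO2_orthogonal/SO2_V.
  by rewrite -[LHS]og !mulmxA mulmxV// mul1mx -!mulmxA sJ1.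
have sqE X : X \in qq -> sqnorm gg X = bilin_form (X *m v) (X *m v).
  exact: (sqnorm_qq l1 ggP hhP hsigma hsigma_fix hqq hv).
have daE := daddv_pi_qq hhP hsigma hsigma_fix hqq.
have normE : metric_sqnorm gg qq (AdS_proj v g) (fundamental_field v J1 g) =
    bilin_form (Ad (invmx g) J1 *m v) (Ad (invmx g) J1 *m v).
  (* The velocity has generator -Ad (g^-1) J1; it is replaced by its q-component, and the sign
     disappears in the square norm. *)
  have NYg : - Ad (invmx g) J1 \in gg by rewrite memvN.
  have Xq := memv_pi qq hh (- Ad (invmx g) J1).
  have Xv := daE _ NYg.
  rewrite fundamental_fieldE//.
  have sX : skew (daddv_pi qq hh (- Ad (invmx g) J1)).
    by have [/ggP] := (mem_qq hqq _).1 Xq.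
  rewrite (velocity_isotropy hg ((ggP _).1 NYg) sX (esym Xv)).
  by rewrite (metric_sqnorm_velocity sqE hg Xq) Xv mulNmx !bilin_formL opprK.
rewrite normE; split.
  by rewrite (sqnorm_daddv_pi l1 ggP hhP hsigma hsigma_fix hqq hv).
(* Ad (g^-1) J1 v = g^-1 J1 (g v), and g^-1 is an isometry. *)
have -> : bilin_form (Ad (invmx g) J1 *m v) (Ad (invmx g) J1 *m v) =
    - 2 * (bilin_form u (g *m v) * bilin_form u' (g *m v)).
  rewrite -(sqnorm_wedge_null _ frame) -J1E /Ad invmxK -!mulmxA -orthogonal_mxV//.
  by rewrite !mulmxA mulmxV// mul1mx.
have opp_w : wedge (- w) v = - wedge w v.
  by rewrite wedgeC -[- w]scaleN1r wedgeZr scaleN1r opprK wedgeC.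
have nnE : nn = nilpotent_part gg (wedge u u') (wedge w v) by rewrite hnn J1E J2wE.
have nnbarE : nnbar = nilpotent_part gg (wedge u' u) (wedge (- w) v).
  rewrite opp_w (wedgeC u') -J1E -J2wE hnnbar hnn /nilpotent_part !limgD.
  by congr (_ + _ + _ + _)%VS; exact: limg_root_space htheta hpp haa hJ.
have aaP' X : X \in aa <->
    exists c d : R, X = c *: wedge u' u + d *: wedge (- w) v.
  rewrite opp_w (wedgeC u'); apply: (iff_trans (aaP X)).
  by split=> -[c [d ->]]; exists (- c), (- d); rewrite !(scalerN, scaleNr, opprK).
have hAN := closed_AN_orbitsP frame ggP aaP hg.
have hANbar := closed_AN_orbitsP (adapted_frame_opp frame) ggP aaP' hg.
rewrite -nnE -hA -hN in hAN; rewrite -nnbarE -hA -hNbar in hANbar.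
split=> [[C [C1|C2] Cg]|/eqP].
- by rewrite hAN.1 ?mul0r ?mulr0//; exists C.
- by rewrite hANbar.1 ?mulr0//; exists C.
rewrite !mulf_eq0 oppr_eq0 pnatr_eq0/= => /orP[/eqP/hAN.2|/eqP/hANbar.2] [C cC Cg].
  by exists C => //; left.
by exists C => //; right.
Qed.
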